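(* Let $d\geq4$. There exists a constant $C=C(d)>0$ depending only on $d$ such that, whenever $a<b$ are real numbers and $G\in L^2(\mathbb{R}\times\mathbb{S}^{d-1})$ is supported in $[a,b]\times\mathbb{S}^{d-1}$, one has for every $R>0$ $$\int_{|x|>R}|(\mathcal{R}^*G)(x)|^{2d}\,dx\leq C\left(\frac{b-a}{R}\right)^{d-1}\|G\|_{L^2}^{2d}.$$
   Context: The adjoint Radon transform is the operator $$(\mathcal{R}^*G)(x)=\int_{\mathbb{S}^{d-1}}G(x\cdot\omega,\omega)\,d\omega,\qquad x\in\mathbb{R}^d,$$ where $d\omega$ is the standard surface measure on the unit sphere $\mathbb{S}^{d-1}\subset\mathbb{R}^d$; for $G\in L^2$ the formula is understood for almost every $x$. $\|G\|_{L^2}$ is the norm of $L^2(\mathbb{R}\times\mathbb{S}^{d-1})$ with respect to $ds\,d\omega$. *)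

(* Defs.v *)
From HB Require Import structures.
From mathcomp Require Import all_boot all_order all_algebra.
From mathcomp Require Import all_classical all_reals all_analysis.
From mathcomp Require Import measurable_realfun.
From mathcomp.real_closed Require Import complex.

Set Implicit Arguments.
Unset Strict Implicit.
Unset Printing Implicit Defensive.

Import Order.TTheory GRing.Theory Num.Theory.
Import numFieldNormedType.Exports.

Local Open Scope classical_set_scope.
Local Open Scope ring_scope.

(* R^d is represented by [d.-tuple R], whose library sigma-algebra is generated
   by the coordinate maps, that is, it is the Borel sigma-algebra of R^d. *)

Section euclidean.
Context {R : realType} {d : nat}.
Implicit Types x y : d.-tuple R.

Definition dotp x y : R := \sum_(i < d) tnth x i * tnth y i.

Definition enorm x : R := Num.sqrt (dotp x x).

Definition sphere : set (d.-tuple R) := [set x | enorm x = 1].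

Definition scalet (r : R) x : d.-tuple R := [tuple r * tnth x i | i < d].

Lemma measurable_enorm : measurable_fun setT enorm.
Proof.
apply: (@measurableT_comp _ _ _ _ _ _ (@Num.sqrt R)).
  by apply: continuous_measurable_fun; exact: sqrt_continuous.
by apply: measurable_sum => i; apply: measurable_funM; exact: measurable_tnth.
Qed.

Lemma measurable_direction :
  measurable_fun setT (fun x => scalet (enorm x)^-1 x).
Proof.
apply/measurable_fun_tnthP => i.
have -> : (@tnth d R ^~ i) \o (fun x => scalet (enorm x)^-1 x)
          = (fun x => enorm x `^ (-1) * tnth x i).
  by apply/funext => x /=; rewrite tnth_mktuple powR_inv1// sqrtr_ge0.
apply: measurable_funM; last exact: measurable_tnth.
apply: (@measurableT_comp _ _ _ _ _ _ (@powR R ^~ (-1))).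
  exact: measurable_powR.
exact: measurable_enorm.
Qed.

End euclidean.

Arguments sphere : clear implicits.

Section lebesgue_tuple.
Context {R : realType}.

Definition tcons n (z : R * n.-tuple R) : n.+1.-tuple R :=
  [tuple of z.1 :: z.2].

Definition tuncons n (t : n.+1.-tuple R) : R * n.-tuple R :=
  (thead t, [tuple of behead t]).

Lemma tconsK n : cancel (@tcons n) (@tuncons n).
Proof.
move=> [a t]; rewrite /tcons /tuncons; congr pair; exact/val_inj.
Qed.

Lemma measurable_tcons n : measurable_fun setT (@tcons n).
Proof. exact: measurable_cons. Qed.

Lemma measurable_tuncons n : measurable_fun setT (@tuncons n).
Proof.
apply/measurable_fun_pairP; split; last exact: measurable_behead.
exact: measurable_tnth.
Qed.

Section step.
Variable n : nat.
Variable mu : {sigma_finite_measure set (n.-tuple R) -> \bar R}.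

Definition lebesgue_cons : set (n.+1.-tuple R) -> \bar R :=
  pushforward (lebesgue_measure \x mu)%E (@tcons n).

HB.instance Definition _ := Measure.copy lebesgue_cons
  (measure_function_pushforward__canonical__measure_function_Measure
     (lebesgue_measure \x mu)%E (@measurable_tcons n)).

Lemma lebesgue_consX (A : set R) (B : set (n.-tuple R)) :
  measurable A -> measurable B ->
  lebesgue_cons (@tuncons n @^-1` (A `*` B)) = (lebesgue_measure A * mu B)%E.
Proof.
move=> mA mB; rewrite /lebesgue_cons /pushforward -comp_preimage.
rewrite (_ : _ \o _ = id) ?preimage_id ?product_measure1E//.
by apply/funext => z; exact: tconsK.
Qed.

Let lebesgue_cons_sigma_finite : sigma_finite setT lebesgue_cons.
Proof.
have /sigma_finiteP[F [TF ndF Foo]] := sigma_finiteT (@lebesgue_measure R).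
have /sigma_finiteP[G [TG ndG Goo]] := sigma_finiteT mu.
exists (fun k => @tuncons n @^-1` (F k `*` G k)).
  apply/seteqP; split => // t _.
  have [i _ Fi] : (\bigcup_i F i) (thead t) by rewrite -TF.
  have [j _ Gj] : (\bigcup_i G i) [tuple of behead t] by rewrite -TG.
  exists (maxn i j) => //; split => /=.
    by move: Fi; exact/subsetPset/ndF/leq_maxl.
  by move: Gj; exact/subsetPset/ndG/leq_maxr.
move=> k; have [mF Fk] := Foo k; have [mG Gk] := Goo k; split.
  rewrite -[X in measurable X]setTI; apply: measurable_tuncons => //.
  exact: measurableX.
by rewrite lebesgue_consX// lte_mul_pinfty// ge0_fin_numE.
Qed.

HB.instance Definition _ := Measure_isSigmaFinite.Build _ _ _ lebesgue_cons
  lebesgue_cons_sigma_finite.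

End step.

Fixpoint lebesgue_tuple n : {sigma_finite_measure set (n.-tuple R) -> \bar R} :=
  if n is n'.+1 then lebesgue_cons (lebesgue_tuple n') else \d_[tuple].

Definition unit_cube n : set (n.-tuple R) :=
  [set x | forall i, `|tnth x i| <= 1].

Lemma tnth_behead_lift n (x : n.+1.-tuple R) (i : 'I_n) :
  tnth [tuple of behead x] i = tnth x (lift ord0 i).
Proof. by rewrite [in RHS](tuple_eta x) tnthS. Qed.

Lemma unit_cubeS n :
  @unit_cube n.+1 = @tuncons n @^-1` (`[-1, 1] `*` @unit_cube n).
Proof.
apply/seteqP; split=> x /=.
  move=> x1; split=> /=.
    by rewrite in_itv/= -ler_norml; exact: x1.
  by move=> i; rewrite tnth_behead_lift; exact: x1.
rewrite in_itv/= -ler_norml => -[x0 x1] i.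
have [->//|i0] := eqVneq i ord0.
have [j ->] : exists j, i = lift ord0 j.
  by case: (unliftP ord0 i) i0 => [j ->|->]; [exists j|rewrite eqxx].
by rewrite -tnth_behead_lift; exact: x1.
Qed.

Lemma unit_cube_lty n :
  measurable (@unit_cube n) /\ (lebesgue_tuple n (@unit_cube n) < +oo)%E.
Proof.
elim: n => [|n [mc ltc]].
  have -> : @unit_cube 0 = setT by apply/seteqP; split => // x _ [].
  by split => //=; rewrite diracT ltry.
have mI : measurable (`[-1, 1]%classic : set R) by exact: measurable_itv.
rewrite unit_cubeS; split.
  rewrite -[X in measurable X]setTI; apply: measurable_tuncons => //.
  exact: measurableX.
rewrite /= lebesgue_consX// lte_mul_pinfty//.
rewrite ge0_fin_numE// lebesgue_measure_itv/= lte_fin; case: ifP => _; exact: ltry.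
Qed.

End lebesgue_tuple.

Arguments lebesgue_tuple : clear implicits.

Section surface_measure.
Context {R : realType} {d : nat}.

Definition cone (A : set (d.-tuple R)) : set (d.-tuple R) :=
  [set x | 0 < enorm x <= 1 /\ A (scalet (enorm x)^-1 x)].

(* The standard surface measure of the unit sphere, as a measure on R^d carried
   by the sphere: in polar coordinates the cone over A has Lebesgue measure
   sigma(A) * \int_0^1 r^(d-1) dr = sigma(A) / d. *)
Definition surface_measure (A : set (d.-tuple R)) : \bar R :=
  (d%:R%:E * lebesgue_tuple R d (cone A))%E.

Lemma enorm_scalet (r : R) (x : d.-tuple R) :
  enorm (scalet r x) = `|r| * enorm x.
Proof.
rewrite /enorm -sqrtr_sqr -sqrtrM ?sqr_ge0//; congr Num.sqrt.
rewrite /dotp mulr_sumr; apply: eq_bigr => i _.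
by rewrite tnth_mktuple mulrACA expr2.
Qed.

Lemma measurable_sphere : measurable (sphere R d).
Proof.
rewrite (_ : sphere R d = enorm @^-1` [set 1])//.
by rewrite -[X in measurable X]setTI; exact: measurable_enorm.
Qed.

Lemma measurable_cone A : measurable A -> measurable (cone A).
Proof.
move=> mA; rewrite (_ : cone A = enorm @^-1` `]0, 1]%classic `&`
    (fun x => scalet (enorm x)^-1 x) @^-1` A); last first.
  by apply/seteqP; split=> x /=; rewrite in_itv/=.
apply: measurableI; rewrite -[X in measurable X]setTI.
  by apply: measurable_enorm => //; exact: measurable_itv.
exact: measurable_direction.
Qed.

Lemma cone_cube A : cone A `<=` @unit_cube R d.
Proof.
move=> x [/andP[_ x1] _] i; apply: le_trans x1.
rewrite -sqrtr_sqr ler_wsqrtr// /dotp (bigD1 i)//= -expr2 lerDl.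
by apply: sumr_ge0 => j _; rewrite -expr2 sqr_ge0.
Qed.

Let surface_measure0 : surface_measure set0 = 0%E.
Proof.
rewrite /surface_measure (_ : cone set0 = set0) ?measure0 ?mule0//.
by apply/seteqP; split=> x // [].
Qed.

Let surface_measure_ge0 A : (0 <= surface_measure A)%E.
Proof. by rewrite /surface_measure mule_ge0// lee_fin. Qed.

Let surface_measure_sigma_additive : semi_sigma_additive surface_measure.
Proof.
move=> F mF tF mUF.
have coneU : cone (\bigcup_n F n) = \bigcup_n cone (F n).
  apply/seteqP; split=> x.
    by move=> [x1 [k _ Fk]]; exists k.
  by move=> [k _ [x1 Fk]]; split => //; exists k.
rewrite /surface_measure coneU.
rewrite [X in X @ _ --> _](_ : _ = (fun n => (d%:R%:E *
    (\sum_(0 <= i < n) lebesgue_tuple R d (cone (F i))))%E)); last first.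
  by apply/funext => k; rewrite ge0_sume_distrr.
apply: cvgeZl => //; apply: measure_semi_sigma_additive.
- by move=> k; exact: measurable_cone.
- apply/trivIsetP => i j _ _ ij; apply/seteqP; split=> x //= -[[_ Fi] [_ Fj]].
  move/trivIsetP : tF => /(_ i j Logic.I Logic.I ij) F0.
  by rewrite -[False]/(set0 (scalet (enorm x)^-1 x)) -F0.
- by rewrite -coneU; exact: measurable_cone.
Qed.

HB.instance Definition _ := isMeasure.Build _ _ _ surface_measure
  surface_measure0 surface_measure_ge0 surface_measure_sigma_additive.

Let surface_measure_fin : fin_num_fun surface_measure.
Proof.
move=> A mA; rewrite ge0_fin_numE//.
have [mc ltc] := @unit_cube_lty R d.
rewrite /surface_measure lte_mul_pinfty ?lee_fin//.
apply: le_lt_trans ltc; apply: le_measure; rewrite ?inE//.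
  exact: measurable_cone.
exact: cone_cube.
Qed.

HB.instance Definition _ := Measure_isFinite.Build _ _ _ surface_measure
  surface_measure_fin.

Lemma surface_measure_sphereC : surface_measure (~` sphere R d) = 0%E.
Proof.
rewrite /surface_measure (_ : cone _ = set0) ?measure0 ?mule0//.
apply/seteqP; split=> x //= -[/andP[x0 _]]; apply.
rewrite /sphere/= enorm_scalet ger0_norm ?invr_ge0 ?ltW// mulVf//.
by rewrite gt_eqF.
Qed.

End surface_measure.

Arguments surface_measure : clear implicits.

Section radon.
Context {R : realType} {d : nat}.
Implicit Types G : R * d.-tuple R -> R[i].

Definition modulus (z : R[i]) : R := Normc.normc z.

(* R x S^(d-1); the values of G outside this set are irrelevant below. *)
Definition cylinder : set (R * d.-tuple R) := setT `*` sphere R d.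

Definition cylinder_measure : {measure set (measurableTypeR R * d.-tuple R) -> \bar R} :=
  (lebesgue_measure \x surface_measure R d)%E.

Definition L2norm G : \bar R :=
  ('N[cylinder_measure]_2%:E[(fun z => (modulus (G z))%:E) \_ cylinder])%E.

Definition in_L2 G : Prop :=
  [/\ measurable_fun cylinder (fun z => complex.Re (G z)),
      measurable_fun cylinder (fun z => complex.Im (G z)) &
      (L2norm G < +oo)%E].

Definition supported_in (a b : R) G : Prop :=
  {ae cylinder_measure,
    forall z, cylinder z -> z.1 \notin `[a, b] -> G z = 0}.

Definition radon_adj_defined G (x : d.-tuple R) : Prop :=
  (surface_measure R d).-integrable (sphere R d)
    (fun w => (modulus (G (dotp x w, w)))%:E).

Definition radon_adj G (x : d.-tuple R) : R[i] :=
  Complex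
    (\int[surface_measure R d]_(w in sphere R d) complex.Re (G (dotp x w, w)))
    (\int[surface_measure R d]_(w in sphere R d) complex.Im (G (dotp x w, w))).

End radon.

Arguments cylinder : clear implicits.

(* Main.v *)
Require Import Defs.
From mathcomp Require Import all_boot all_order all_algebra.
From mathcomp Require Import all_classical all_reals all_analysis.
From mathcomp Require Import ring lra measurable_realfun.
From mathcomp.real_closed Require Import complex.
Import Order.TTheory GRing.Theory Num.Theory.
Import numFieldNormedType.Exports.
Local Open Scope classical_set_scope.
Local Open Scope ring_scope.

(** The statement only concerns g = |G|: the modulus of the transform of G at x is
    at most twice the dual transform u (x), the integral of g (x . w, w) over the
    sphere.  Let d be the dimension, v a truncation of u to |x| > r that is bounded
    with bounded support, and E the integral of v^(2d).

    Pairing u with f = v^(2d-1) and exchanging the integrals (pairing_hyper_int)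
    turns E into a pairing of g with the integrals of f over the hyperplanes
    w . y = c.  Here the sphere is replaced by the unit ball, w / |w| being the
    direction, so that hyperplanes become functions of two vectors in duality and
    the measure delta (w . y) dw dy can be used symmetrically (hyper_int_swap).
    By Young's inequality E is then at most l times the square of the L^2 norm of g
    plus 1 / l times the quadratic form of T T^* in f, for every l > 0, T being the
    dual transform restricted to functions supported in [a, b].

    The kernel of T T^* at x and x + y (quadratic_hyper_int) measures the
    hyperplanes through both points whose signed distance to the origin lies in
    [a, b]: it is 1 / |y| times the volume of a sector of the unit ball of the
    orthogonal complement of y, of opening (b - a) |y| / |x ^ y|, where |x ^ y|
    is the area spanned by x and y.  As d >= 4 that volume is at most linear in
    the opening (measure_sector), so the kernel is at most a multiple of 1 / m
    with m = max (|y|, |x ^ y| / (b - a)) (hyper_int_strip).  For |x| > r the y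
    with m < t lie in a tube about the line through 0 and x, of length 2 t and
    radius (b - a) t / r, so their measure is at most A t^d with A a multiple of
    ((b - a) / r)^(d-1) (measure_strip_ball).

    A kernel of this weak type obeys a Hardy-Littlewood-Sobolev inequality
    (weak_kernel_bound): writing E = A beta^d, the quadratic form is at most a
    multiple of A beta^(d-1) E.  Choosing l so as to absorb this term in E,
    which is finite by truncation, bounds beta by a multiple of the square of
    the L^2 norm, that is, E by a multiple of A |g|^(2d) (backproj_bound).
    Monotone convergence removes the truncation (backproj_Lp), and the
    finiteness of the resulting integrals for all r shows that u is finite
    almost everywhere. *)

Set Implicit Arguments.
Unset Strict Implicit.
Unset Printing Implicit Defensive.

(** * Affine substitutions on the line *)

Section real_line.
Context {R : realType}.
Local Open Scope ereal_scope.
Implicit Types f : R -> \bar R.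

(** Up to the factor, the image of Lebesgue measure under the substitution gives
    half-open intervals their length, and this determines the measure. *)
Lemma ge0_integral_affine (a b : R) f : a != 0%R ->
  measurable_fun setT f -> (forall t, 0 <= f t) ->
  \int[lebesgue_measure]_t f (a * t + b)%R =
  (`|a|^-1)%:E * \int[lebesgue_measure]_t f t.
Proof.
move=> a0 mf f0.
pose h (t : measurableTypeR R) : measurableTypeR R := (a * t + b)%R.
have mh : measurable_fun setT h.
  by apply: measurable_funD => //; apply: measurable_funM.
have a1 : (0 <= `|a|)%R by [].
pose nu := measure_function_pushforward__canonical__measure_function_Measure
  (@lebesgue_measure R) mh.
pose mu := mscale (NngNum a1) nu.
rewrite [X in _ = _ * X](@eq_measure_integral _ _ _ _ mu); last first.
  move=> A mA _; apply: (@lebesgue_measure_unique _ mu) => // X -[[p q]/= pq <-].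
  rewrite /mu /mscale /= /nu /= /pushforward.
  have ia : (0 < `|a|^-1)%R by rewrite invr_gt0 normr_gt0.
  have [ap|an] := ltP 0%R a.
    have -> : h @^-1` `]p, q] = `]((p - b) / a)%R, ((q - b) / a)%R]%classic.
      by apply/seteqP; split=> x /=; rewrite !in_itv/= /h ler_pdivlMr// ltr_pdivrMr//;
        rewrite (mulrC x) lerBrDr ltrBlDr.
    rewrite !lebesgue_measure_itv/= !lte_fin ltr_pM2r ?invr_gt0//.
    rewrite ltrD2r; case: ifPn => _; last by rewrite mule0.
    rewrite -!EFinD -EFinM gtr0_norm//; congr EFin.
    by field.
  have an' : (a < 0)%R by rewrite lt_neqAle a0.
  have -> : h @^-1` `]p, q] = `[((q - b) / a)%R, ((p - b) / a)%R[%classic.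
    apply/seteqP; split=> x /=; rewrite !in_itv/= /h ler_ndivrMr// ltr_ndivlMr//;
      by rewrite (mulrC x) lerBrDr ltrBlDr andbC.
  rewrite !lebesgue_measure_itv/= !lte_fin ltr_nM2r ?invr_lt0//.
  rewrite ltrD2r; case: ifPn => _; last by rewrite mule0.
  rewrite -!EFinD -EFinM ltr0_norm//; congr EFin.
  by field.
rewrite ge0_integral_mscale// ge0_integral_pushforward//= preimage_setT.
by rewrite muleA -EFinM mulVf ?mul1e ?normr_eq0.
Qed.

End real_line.

(** * Euclidean geometry of tuples *)

Section tuples.
Context {R : realType}.

Definition addt n (x y : n.-tuple R) : n.-tuple R :=
  [tuple tnth x i + tnth y i | i < n].

Lemma tnth_tcons0 n (t : R) (v : n.-tuple R) : tnth (tcons (t, v)) ord0 = t.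
Proof. by []. Qed.

Lemma tnth_tconsS n (t : R) (v : n.-tuple R) i :
  tnth (tcons (t, v)) (lift ord0 i) = tnth v i.
Proof. by rewrite /tcons tnthS. Qed.

Lemma eq_tcons n (x y : n.+1.-tuple R) :
  tnth x ord0 = tnth y ord0 ->
  (forall i, tnth x (lift ord0 i) = tnth y (lift ord0 i)) -> x = y.
Proof.
move=> h0 hS; apply: eq_from_tnth => i.
by case: (unliftP ord0 i) => [j ->|->].
Qed.

Lemma tunconsK n : cancel (@tuncons R n) (@tcons R n).
Proof. by move=> x; rewrite /tcons /tuncons/= -tuple_eta. Qed.

Lemma dotp_tcons n t s (v w : n.-tuple R) :
  dotp (tcons (t, v)) (tcons (s, w)) = t * s + dotp v w.
Proof.
rewrite /dotp big_ord_recl !tnth_tcons0; congr (_ + _).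
by apply: eq_bigr => i _; rewrite !tnth_tconsS.
Qed.

Lemma addt_tcons n t s (v w : n.-tuple R) :
  addt (tcons (t, v)) (tcons (s, w)) = tcons (t + s, addt v w).
Proof.
apply: eq_tcons => [|i]; first by rewrite tnth_mktuple !tnth_tcons0.
by rewrite tnth_mktuple !tnth_tconsS tnth_mktuple.
Qed.

Lemma scalet_tcons n t s (v : n.-tuple R) :
  scalet s (tcons (t, v)) = tcons (s * t, scalet s v).
Proof.
apply: eq_tcons => [|i]; first by rewrite tnth_mktuple !tnth_tcons0.
by rewrite tnth_mktuple !tnth_tconsS tnth_mktuple.
Qed.

Lemma dotpC n (x y : n.-tuple R) : dotp x y = dotp y x.
Proof. by apply: eq_bigr => i _; rewrite mulrC. Qed.

Lemma dotpDr n (x y z : n.-tuple R) : dotp x (addt y z) = dotp x y + dotp x z.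
Proof.
by rewrite /dotp -big_split/=; apply: eq_bigr => i _; rewrite tnth_mktuple mulrDr.
Qed.

Lemma dotpDl n (x y z : n.-tuple R) : dotp (addt y z) x = dotp y x + dotp z x.
Proof. by rewrite dotpC dotpDr !(dotpC x). Qed.

Lemma dotpZr n (x y : n.-tuple R) a : dotp x (scalet a y) = a * dotp x y.
Proof.
by rewrite /dotp mulr_sumr; apply: eq_bigr => i _; rewrite tnth_mktuple mulrCA.
Qed.

Lemma dotpZl n (x y : n.-tuple R) a : dotp (scalet a x) y = a * dotp x y.
Proof. by rewrite dotpC dotpZr dotpC. Qed.

Lemma dotp_ge0 n (x : n.-tuple R) : 0 <= dotp x x.
Proof. by apply: sumr_ge0 => i _; rewrite -expr2 sqr_ge0. Qed.

Lemma dotp_eq0 n (x : n.-tuple R) : dotp x x = 0 -> forall i, tnth x i = 0.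
Proof.
move=> /eqP; rewrite psumr_eq0 => [/allP h i|i _]; last by rewrite -expr2 sqr_ge0.
by have /= := h i; rewrite mem_index_enum mulf_eq0 orbb => /(_ isT)/eqP.
Qed.

Lemma sqr_enorm n (x : n.-tuple R) : enorm x ^+ 2 = dotp x x.
Proof. by rewrite sqr_sqrtr// dotp_ge0. Qed.

Lemma enorm_ge0 n (x : n.-tuple R) : 0 <= enorm x.
Proof. exact: sqrtr_ge0. Qed.

Lemma enorm_tcons n t (v : n.-tuple R) :
  enorm (tcons (t, v)) ^+ 2 = t ^+ 2 + enorm v ^+ 2.
Proof. by rewrite !sqr_enorm dotp_tcons expr2. Qed.

Lemma addtC n (x y : n.-tuple R) : addt x y = addt y x.
Proof. by apply: eq_from_tnth => i; rewrite !tnth_mktuple addrC. Qed.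

Lemma addtNK n (x y : n.-tuple R) : addt (addt y (scalet (-1) x)) x = y.
Proof. by apply: eq_from_tnth => i; rewrite !tnth_mktuple mulN1r subrK. Qed.

(** Reflection in the hyperplane orthogonal to [v]; since 0^-1 = 0 it is the
    identity for v = 0. *)
Definition reflect_along n (v z : n.-tuple R) : n.-tuple R :=
  addt z (scalet (- (2 * dotp v z / dotp v v)) v).

(** Self-adjoint involutions: the two identities force linearity and invariance
    of the norm, and reflections, which satisfy them, already carry any vector to
    any other vector of the same norm. *)
Record is_isometry n (O : n.-tuple R -> n.-tuple R) : Prop := IsIsometry {
  isomK : forall x, O (O x) = x ;
  isom_dotp : forall x y, dotp (O x) y = dotp x (O y) ;
  isom_meas : measurable_fun setT O }.

Lemma dotp_ext n (x y : n.-tuple R) : (forall z, dotp x z = dotp y z) -> x = y.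
Proof.
move=> xy; apply: eq_from_tnth => i.
have D (u : n.-tuple R) : dotp u [tuple (j == i)%:R | j < n] = tnth u i.
  rewrite /dotp (bigD1 i)//= tnth_mktuple eqxx mulr1 big1 ?addr0// => j ji.
  by rewrite tnth_mktuple (negbTE ji) mulr0.
by rewrite -!D xy.
Qed.

Section isometry.
Variables (n : nat) (O : n.-tuple R -> n.-tuple R).
Hypothesis iO : is_isometry O.

Lemma isomD x y : O (addt x y) = addt (O x) (O y).
Proof.
by apply: dotp_ext => z; rewrite dotpDl !(isom_dotp iO) dotpDl.
Qed.

Lemma isomZ a x : O (scalet a x) = scalet a (O x).
Proof. by apply: dotp_ext => z; rewrite dotpZl !(isom_dotp iO) dotpZl. Qed.

Lemma enorm_isom x : enorm (O x) = enorm x.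
Proof. by rewrite /enorm (isom_dotp iO) (isomK iO). Qed.

End isometry.

Definition zerot n : n.-tuple R := [tuple 0 | _ < n].

Lemma dotp0l n (x : n.-tuple R) : dotp (zerot n) x = 0.
Proof. by rewrite /dotp big1// => i _; rewrite tnth_mktuple mul0r. Qed.

Lemma dotp0r n (x : n.-tuple R) : dotp x (zerot n) = 0.
Proof. by rewrite dotpC dotp0l. Qed.

Lemma enorm_axis n (a : R) : enorm (tcons (a, zerot n)) = `|a|.
Proof. by rewrite /enorm dotp_tcons dotp0l addr0 -expr2 sqrtr_sqr. Qed.

Definition inball n (r : R) (x : n.-tuple R) : bool := enorm x <= r.

(** For c = x . w the hyperplane through x orthogonal to w lies at signed
    distance c / |w| from the origin; the condition places it between a and b,
    for w in the punctured unit ball. *)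
Definition in_strip d (a b : R) (w : d.-tuple R) (c : R) : bool :=
  ((0 < enorm w) && ((enorm w <= 1) &&
   ((a * enorm w < c) && (c <= b * enorm w)))).

(** The area of the parallelogram spanned by x and y. *)
Definition wedge d (x y : d.-tuple R) : R :=
  Num.sqrt (dotp x x * dotp y y - dotp x y ^+ 2).

(** The reciprocal of this quantity is the size of the kernel at x and x + y of
    the dual transform composed with its adjoint: the directions orthogonal to y
    contribute 1 / |y|, and among them those whose hyperplane through x meets a
    given interval of length h contribute only h / |x ^ y|. *)
Definition strip_dist d (h : R) (x y : d.-tuple R) : R :=
  Num.max (enorm y) (wedge x y / h).

End tuples.

(** * Measurability of explicit formulas *)

Section measurability.
Context {R : realType} d (T : measurableType d).
Implicit Types n : nat.

Lemma measurable_dotp n (f g : T -> n.-tuple R) :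
  measurable_fun setT f -> measurable_fun setT g ->
  measurable_fun setT (fun x => dotp (f x) (g x)).
Proof.
move=> /measurable_fun_tnthP mf /measurable_fun_tnthP mg.
apply: measurable_sum => i; apply: measurable_funM; [exact: mf|exact: mg].
Qed.

Lemma measurable_addt n (f g : T -> n.-tuple R) :
  measurable_fun setT f -> measurable_fun setT g ->
  measurable_fun setT (fun x => addt (f x) (g x)).
Proof.
move=> /measurable_fun_tnthP mf /measurable_fun_tnthP mg.
apply/measurable_fun_tnthP => i.
rewrite (_ : _ \o _ = fun x => tnth (f x) i + tnth (g x) i); last first.
  by apply/funext => x /=; rewrite tnth_mktuple.
by apply: measurable_funD; [exact: mf|exact: mg].
Qed.

Lemma measurable_scalet n (f : T -> R) (g : T -> n.-tuple R) :
  measurable_fun setT f -> measurable_fun setT g ->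
  measurable_fun setT (fun x => scalet (f x) (g x)).
Proof.
move=> mf /measurable_fun_tnthP mg.
apply/measurable_fun_tnthP => i.
rewrite (_ : _ \o _ = fun x => f x * tnth (g x) i); last first.
  by apply/funext => x /=; rewrite tnth_mktuple.
by apply: measurable_funM => //; exact: mg.
Qed.

Lemma measurable_tconsT n (f : T -> R) (g : T -> n.-tuple R) :
  measurable_fun setT f -> measurable_fun setT g ->
  measurable_fun setT (fun x => tcons (f x, g x)).
Proof. exact: measurable_cons. Qed.

Lemma measurable_tunconsT n (f : T -> n.+1.-tuple R) :
  measurable_fun setT f -> measurable_fun setT (fun x => tuncons (f x)).
Proof. by move=> mf; apply: (measurableT_comp (@measurable_tuncons _ _)). Qed.

Lemma measurable_enormT n (f : T -> n.-tuple R) :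
  measurable_fun setT f -> measurable_fun setT (fun x => enorm (f x)).
Proof. by move=> mf; apply: (measurableT_comp measurable_enorm). Qed.

Lemma measurable_invr (f : T -> R) :
  measurable_fun setT f -> measurable_fun setT (fun x => (f x)^-1).
Proof.
move=> mf; apply: (@measurableT_comp _ _ _ _ _ _ (@GRing.inv R)) => //.
have -> : @GRing.inv R = (fun t => Num.sg t * `|t| `^ (-1)).
  apply/funext => t; rewrite powR_inv1//.
  case: (ltgtP 0 t) => [t0|t0|<-]; last by rewrite sgr0 mul0r invr0.
    by rewrite gtr0_sg// gtr0_norm// mul1r.
  by rewrite ltr0_sg// ltr0_norm// invrN mulN1r opprK.
apply: measurable_funM.
  rewrite (_ : Num.sg = fun t : R => if 0 < t then 1 else if t < 0 then -1 else 0).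
    apply: measurable_fun_ifT => //; first exact: measurable_fun_ltr.
    by apply: measurable_fun_ifT => //; exact: measurable_fun_ltr.
  by apply/funext => t; case: (ltgtP 0 t) => [/gtr0_sg|/ltr0_sg|<-] //; rewrite sgr0.
exact: (measurableT_comp (measurable_powR _)).
Qed.

Lemma measurable_pairT d1 d2 (T1 : measurableType d1) (T2 : measurableType d2)
    (f : T -> T1) (g : T -> T2) :
  measurable_fun setT f -> measurable_fun setT g ->
  measurable_fun setT (fun x => (f x, g x)).
Proof. by move=> mf mg; apply/measurable_fun_pairP; split. Qed.

Lemma measurable_EFinT (f : T -> R) :
  measurable_fun setT f -> measurable_fun setT (fun x => (f x)%:E).
Proof. by move=> mf; exact/measurable_EFinP. Qed.

Lemma measurable_natr (f : T -> bool) :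
  measurable_fun setT f -> measurable_fun setT (fun x => ((f x)%:R : R)).
Proof.
move=> mf; rewrite (_ : (fun x => _) = (fun x => if f x then 1 else 0)).
  exact: measurable_fun_ifT.
by apply/funext => x; case: (f x).
Qed.

Lemma measurable_inball n r (f : T -> n.-tuple R) :
  measurable_fun setT f -> measurable_fun setT (fun x => inball r (f x)).
Proof.
by move=> mf; apply: measurable_fun_ler => //; exact: measurable_enormT.
Qed.

Lemma measurable_wedge n (f g : T -> n.-tuple R) :
  measurable_fun setT f -> measurable_fun setT g ->
  measurable_fun setT (fun z => wedge (f z) (g z)).
Proof.
move=> mf mg; apply: (@measurableT_comp _ _ _ _ _ _ (@Num.sqrt R)).
  by apply: continuous_measurable_fun; exact: sqrt_continuous.
apply: measurable_funB.
  by apply: measurable_funM; exact: measurable_dotp.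
by apply: measurable_funX; exact: measurable_dotp.
Qed.

Lemma measurable_strip_dist n h (f g : T -> n.-tuple R) :
  measurable_fun setT f -> measurable_fun setT g ->
  measurable_fun setT (fun z => strip_dist h (f z) (g z)).
Proof.
move=> mf mg; apply: measurable_maxr; first exact: measurable_enormT.
by apply: measurable_funM => //; exact: measurable_wedge.
Qed.

Lemma measurable_in_strip n a b (f : T -> n.-tuple R) (g : T -> R) :
  measurable_fun setT f -> measurable_fun setT g ->
  measurable_fun setT (fun z => in_strip a b (f z) (g z)).
Proof.
move=> mf mg; have me := measurable_enormT mf.
apply: measurable_and; first exact: measurable_fun_ltr.
apply: measurable_and; first exact: measurable_fun_ler.
apply: measurable_and.
  by apply: measurable_fun_ltr => //; exact: measurable_funM.
by apply: measurable_fun_ler => //; exact: measurable_funM.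
Qed.

End measurability.

Ltac measurable_comp :=
  match goal with
  | H : measurable_fun _ ?f |- measurable_fun _ ?g =>
    lazymatch g with
    | (fun x => f _) => apply: (measurableT_comp H)
    | (f \o _) => apply: (measurableT_comp H)
    end
  end.

(** Decomposes a formula along its head symbol, so that only the variable
    functions, treated by the previous tactic, need hypotheses. *)
Ltac measurability_step :=
  lazymatch goal with
  | |- measurable_fun _ (fun x => x) => exact: measurable_id
  | |- measurable_fun _ (fun x => (_, _)) => apply: measurable_pairT
  | |- measurable_fun _ (fun x => EFin _) => apply: measurable_EFinT
  | |- measurable_fun _ (fun x => mule _ _) => apply: emeasurable_funM
  | |- measurable_fun _ (fun x => (nat_of_bool _)%:R%R) => apply: measurable_natr
  | |- measurable_fun _ (fun x => enorm _) => apply: measurable_enormT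
  | |- measurable_fun _ (fun x => inball _ _) => apply: measurable_inball
  | |- measurable_fun _ (inball _) => apply: measurable_inball
  | |- measurable_fun _ (fun x => in_strip _ _ _ _) => apply: measurable_in_strip
  | |- measurable_fun _ (fun x => strip_dist _ _ _) => apply: measurable_strip_dist
  | |- measurable_fun _ (strip_dist _ _) => apply: measurable_strip_dist
  | |- measurable_fun _ (fun x => dotp _ _) => apply: measurable_dotp
  | |- measurable_fun _ (fun x => addt _ _) => apply: measurable_addt
  | |- measurable_fun _ (fun x => scalet _ _) => apply: measurable_scalet
  | |- measurable_fun _ (fun x => tcons _) => apply: measurable_tconsT
  | |- measurable_fun _ (fun x => tuncons _) => apply: measurable_tunconsT
  | |- measurable_fun _ (fun x => eq_op _ _) => apply: measurable_fun_eqr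
  | |- measurable_fun _ (fun x => andb _ _) => apply: measurable_and
  | |- measurable_fun _ (fun x => negb _) => apply: measurable_neg
  | |- measurable_fun _ (fun x => Order.lt _ _) => apply: measurable_fun_ltr
  | |- measurable_fun _ (fun x => Order.le _ _) => apply: measurable_fun_ler
  | |- measurable_fun _ (fun x => GRing.inv _) => apply: measurable_invr
  | |- measurable_fun _ (fun x => GRing.exp _ _) => apply: measurable_funX
  | |- measurable_fun _ (fun x => GRing.opp _) => apply: measurable_funN
  | |- measurable_fun _ (fun x => GRing.add _ (GRing.opp _)) =>
      apply: measurable_funB
  | |- measurable_fun _ (fun x => GRing.add _ _) =>
      first [apply: measurable_funD | apply: emeasurable_funD]
  | |- measurable_fun _ (fun x => GRing.mul _ _) => apply: measurable_funM
  | |- measurable_fun _ (fun x => Num.norm _) =>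
      apply: (measurableT_comp (@normr_measurable _ setT))
  | |- measurable_fun _ (fun x => fst _) => apply: (measurableT_comp measurable_fst)
  | |- measurable_fun _ (fun x => snd _) => apply: (measurableT_comp measurable_snd)
  | |- measurable_fun _ fst => exact: measurable_fst
  | |- measurable_fun _ snd => exact: measurable_snd
  | |- measurable_fun _ (@GRing.inv _) => apply: measurable_invr
  | |- measurable_fun _ (GRing.mul _) => apply: measurable_funM
  | |- measurable_fun _ (Order.le _) => apply: measurable_fun_ler
  | |- measurable_fun _ (@tuncons _ _) => exact: measurable_tuncons
  | |- measurable_fun _ (addt _) => apply: measurable_addt
  | |- measurable_fun _ (dotp _) => apply: measurable_dotp
  | |- measurable_fun _ (scalet _) => apply: measurable_scalet
  | |- measurable_fun _ (@enorm _ _) => apply: measurable_enormT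
  end.

Ltac measurability :=
  repeat first [ assumption | exact: measurable_cst | measurable_comp
               | measurability_step ].

(** * Lebesgue measure on tuples *)

Section lebesgue_tuple_theory.
Context {R : realType}.
Local Open Scope ereal_scope.
Notation leb := (@lebesgue_measure R).
Notation RR := (measurableTypeR R).
Notation lam n := (lebesgue_tuple R n).

Lemma measurable_tconsR n : measurable_fun setT (@tcons R n : RR * n.-tuple R -> _).
Proof. exact: measurable_tcons. Qed.

Lemma integral_tcons n (f : n.+1.-tuple R -> \bar R) :
  measurable_fun setT f -> (forall x, 0 <= f x) ->
  \int[lam n.+1]_x f x = \int[leb]_t \int[lam n]_v f (tcons (t, v)).
Proof.
move=> mf f0; have mtc := @measurable_tconsR n.
have mft := measurableT_comp mf mtc.
have f00 : {in [set: n.+1.-tuple R], forall x, 0 <= f x} by move=> x _.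
have := @ge0_integral_pushforward _ _ _ _ R _ mtc
  (leb \x lam n)%E setT f measurableT mf f00.
rewrite preimage_setT => E; apply: etrans E _.
by rewrite (fubini_tonelli1 _ mft (fun z => f0 _)).
Qed.

Lemma integral_tcons2 n (f : n.+1.-tuple R -> \bar R) :
  measurable_fun setT f -> (forall x, 0 <= f x) ->
  \int[lam n.+1]_x f x = \int[lam n]_v \int[leb]_t f (tcons (t, v)).
Proof.
move=> mf f0; rewrite integral_tcons//.
have mft := measurableT_comp mf (@measurable_tconsR n).
exact: (fubini_tonelli _ mft (fun z => f0 _)).
Qed.

Lemma measurable_int1 d1 d2 (T1 : measurableType d1) (T2 : measurableType d2)
    (m2 : {sigma_finite_measure set T2 -> \bar R}) (f : T1 -> T2 -> \bar R) :
  measurable_fun setT (fun z => f z.1 z.2) -> (forall x y, 0 <= f x y) ->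
  measurable_fun setT (fun x => \int[m2]_y f x y).
Proof.
move=> mf f0; exact: (measurable_fun_fubini_tonelli_F (fun z => f z.1 z.2)).
Qed.

Lemma tonelli d1 d2 (T1 : measurableType d1) (T2 : measurableType d2)
    (m1 : {sigma_finite_measure set T1 -> \bar R})
    (m2 : {sigma_finite_measure set T2 -> \bar R}) (f : T1 -> T2 -> \bar R) :
  measurable_fun setT (fun z => f z.1 z.2) -> (forall x y, 0 <= f x y) ->
  \int[m1]_x \int[m2]_y f x y = \int[m2]_y \int[m1]_x f x y.
Proof.
move=> mf f0; exact: (fubini_tonelli (fun z => f z.1 z.2)).
Qed.

Lemma ge0_integralZ d (T : measurableType d) (m : {measure set T -> \bar R})
    (k : \bar R) (f : T -> \bar R) :
  measurable_fun setT f -> (forall x, 0 <= f x) -> 0 <= k ->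
  \int[m]_x (k * f x) = k * \int[m]_x f x.
Proof. by move=> mf f0 k0; apply: ge0_integralZl. Qed.

Lemma le_integral_ge0 d (T : measurableType d) (m : {measure set T -> \bar R})
    (f g : T -> \bar R) :
  measurable_fun setT f -> measurable_fun setT g ->
  (forall x, 0 <= f x) -> (forall x, f x <= g x) ->
  \int[m]_x f x <= \int[m]_x g x.
Proof. by move=> mf mg f0 fg; apply: ge0_le_integral. Qed.

Lemma integral_bool d (T : measurableType d) (m : {measure set T -> \bar R})
    (b : T -> bool) : measurable_fun setT b ->
  \int[m]_x ((b x)%:R)%:E = m [set x | b x].
Proof.
move=> mb.
have mB : measurable [set x | b x].
  have -> : [set x | b x] = setT `&` b @^-1` [set true].
    by rewrite setTI; apply/seteqP; split=> x /= ->.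
  exact: mb.
rewrite -[X in m X]setIT -integral_indic//.
apply: eq_integral => x _; rewrite indicE; congr (_%:R%:E)%R.
by case: (boolP (b x)) => bx; [rewrite mem_set|rewrite memNset//; exact/negP].
Qed.

(** Coordinate by coordinate, by Fubini and the substitution rule on the line. *)
Lemma integral_addt n (a : n.-tuple R) (f : n.-tuple R -> \bar R) :
  measurable_fun setT f -> (forall x, 0 <= f x) ->
  \int[lam n]_x f (addt a x) = \int[lam n]_x f x.
Proof.
elim: n a f => [|n IH] a f mf f0.
  by apply: eq_integral => x _; rewrite (tuple0 x) (tuple0 (addt _ _)).
rewrite -[a]tunconsK; case: (tuncons a) => s w.
rewrite (integral_tcons (f := f \o addt (tcons (s, w)))); last 2 first.
- by measurability.
- by move=> x; exact: f0.
rewrite integral_tcons//.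
transitivity (\int[leb]_t \int[lam n]_v f (tcons ((1 * t + s)%R, v))).
  apply: eq_integral => t _.
  rewrite -(IH w (fun v => f (tcons ((1 * t + s)%R, v))))//; last by measurability.
  by apply: eq_integral => v _; rewrite /= addt_tcons mul1r addrC.
rewrite (ge0_integral_affine s (f := fun t => \int[lam n]_v f (tcons (t, v))))//.
- by rewrite normr1 invr1 mul1e.
- apply: measurable_int1 => //; measurability.
- by move=> t; apply: integral_ge0.
Qed.

Lemma integral_scalet n (r : R) (f : n.-tuple R -> \bar R) : r != 0%R ->
  measurable_fun setT f -> (forall x, 0 <= f x) ->
  \int[lam n]_x f (scalet r x) = ((`|r|^-1)^+n)%:E * \int[lam n]_x f x.
Proof.
move=> r0; elim: n f => [|n IH] f mf f0.
  by rewrite expr0 mul1e; apply: eq_integral => x _; rewrite (tuple0 x) (tuple0 (scalet _ _)).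
rewrite !integral_tcons//; last by measurability.
transitivity (\int[leb]_t (((`|r|^-1)^+n)%:E * \int[lam n]_v f (tcons ((r * t + 0)%R, v)))).
  apply: eq_integral => t _.
  rewrite -(IH (fun v => f (tcons ((r * t + 0)%R, v))))//; last by measurability.
  by apply: eq_integral => v _; rewrite scalet_tcons addr0.
rewrite (ge0_integral_affine 0
  (f := fun t => (((`|r|^-1)^+n)%:E * \int[lam n]_v f (tcons (t, v)))))//.
- rewrite ge0_integralZ ?lee_fin ?exprn_ge0//.
  + by rewrite muleA -EFinM exprS.
  + apply: measurable_int1 => //; measurability.
  + by move=> t; apply: integral_ge0.
- apply: emeasurable_funM => //; apply: measurable_int1 => //; measurability.
- by move=> t; apply: mule_ge0; [rewrite lee_fin exprn_ge0|apply: integral_ge0].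
Qed.

Definition ball_vol n : R := fine (lam n [set x | inball 1 x]).

Lemma enorm_comp n (x : n.-tuple R) i : (`|tnth x i| <= enorm x)%R.
Proof.
rewrite -sqrtr_sqr ler_wsqrtr// /dotp (bigD1 i)//= -expr2 lerDl.
by apply: sumr_ge0 => j _; rewrite -expr2 sqr_ge0.
Qed.

Lemma measurable_boolset d (T : measurableType d) (b : T -> bool) :
  measurable_fun setT b -> measurable [set x | b x].
Proof.
move=> mb; have -> : [set x | b x] = setT `&` b @^-1` [set true].
  by rewrite setTI; apply/seteqP; split=> x /= ->.
exact: mb.
Qed.

Lemma ball_volE n : lam n [set x | inball 1 x] = (ball_vol n)%:E.
Proof.
rewrite /ball_vol fineK// ge0_fin_numE//.
have [mc ltc] := @unit_cube_lty R n.
apply: le_lt_trans ltc; apply: le_measure; rewrite ?inE//.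
  by apply: measurable_boolset; measurability.
by move=> x /= h i; apply: le_trans (enorm_comp x i) h.
Qed.

Lemma ball_vol_ge0 n : (0 <= ball_vol n)%R.
Proof. by rewrite -lee_fin -ball_volE. Qed.

Lemma measure_ball n (r : R) : (0 < r)%R ->
  lam n [set x | inball r x] = (r ^+ n * ball_vol n)%:E.
Proof.
move=> r0; have mb r' : measurable_fun setT (@inball R n r').
  by measurability.
rewrite -integral_bool//.
have := @integral_scalet n r^-1 (fun x => ((inball 1 x)%:R)%:E).
rewrite invr_eq0 gt_eqF// => /(_ isT).
have E1 : \int[lam n]_x ((inball 1%R x)%:R)%:E = (ball_vol n)%:E.
  exact: etrans (integral_bool _ (mb 1%R)) (ball_volE n).
rewrite E1 gtr0_norm ?invr_gt0// invrK EFinM => <- //.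
- apply: eq_integral => x _; rewrite /inball enorm_scalet gtr0_norm ?invr_gt0//.
  by rewrite mulrC ler_pdivrMr// mul1r.
- by measurability.
Qed.

Lemma measure_unit_cube n : lam n (@unit_cube R n) = (2 ^+ n)%:E.
Proof.
elim: n => [|n IH].
  have -> : @unit_cube R 0 = setT by apply/seteqP; split => // x _ [].
  by rewrite /= diracT expr0.
have [mc _] := @unit_cube_lty R n.
rewrite unit_cubeS /= lebesgue_consX//.
transitivity ((2%:E : \bar R) * (2 ^+ n)%:E); last by rewrite -EFinM exprS.
congr (_ * _); last exact: IH.
by rewrite lebesgue_measure_itv/= lte_fin ifT -?EFinB ?opprK//; lra.
Qed.

(** The ball of radius n + 1 contains the unit cube. *)
Lemma ball_vol_gt0 n : (0 < ball_vol n)%R.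
Proof.
have [mc ltc] := @unit_cube_lty R n.
have k0 : (0 < n.+1%:R :> R)%R by rewrite ltr0n.
have : (0 : \bar R) < lam n [set x | inball n.+1%:R x].
  apply: (@lt_le_trans _ _ (lam n (@unit_cube R n))).
    by rewrite measure_unit_cube lte_fin exprn_gt0.
  apply: le_measure; rewrite ?inE//.
    by apply: measurable_boolset; measurability.
  move=> x /= xc; rewrite /inball -(@ler_pXn2r _ 2) ?nnegrE ?enorm_ge0// sqr_enorm.
  apply: (@le_trans _ _ (\sum_(i < n) (1:R))%R).
    apply: ler_sum => i _; rewrite -expr2 -real_normK ?num_real// exprn_ile1//.
  rewrite sumr_const card_ord -natrX ler_nat.
  by apply: (@leq_trans n.+1) => //; rewrite -{1}(expn1 n.+1) leq_pexp2l.
by rewrite measure_ball// lte_fin pmulr_rgt0// exprn_gt0.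
Qed.

Section isometry_invariance.
Variable n : nat.
Implicit Types O : n.-tuple R -> n.-tuple R.

(** Uniqueness of Haar measure, in the form of a double integral of
    F (O x) 1_B (y + O x) computed in two ways: for O linear and isometric, both
    x |-> x - O y and y |-> y + O x are measure preserving, and the ball B is
    invariant under O. *)
Lemma integral_isometry_opp O (F : n.-tuple R -> \bar R) : is_isometry O ->
  measurable_fun setT F -> (forall x, 0 <= F x) ->
  \int[lam n]_x F (O x) = \int[lam n]_x F (scalet (-1) x).
Proof.
move=> iO mF F0; have mO := isom_meas iO.
pose b (x : n.-tuple R) : \bar R := ((inball 1%R x)%:R)%:E.
have mb : measurable_fun setT b.
  by rewrite /b; measurability.
have b0 x : 0 <= b x by rewrite lee_fin.
have Eb : \int[lam n]_x b x = (ball_vol n)%:E.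
  apply: etrans (integral_bool _ _) (ball_volE n).
  by measurability.
have [c0 Vn0] : 0 <= (ball_vol n)%:E /\ (ball_vol n != 0)%R.
  by rewrite lee_fin ball_vol_ge0 gt_eqF// ball_vol_gt0.
suff : (ball_vol n)%:E * \int[lam n]_x F (O x) =
       (ball_vol n)%:E * \int[lam n]_x F (scalet (-1) x).
  move/(congr1 (fun z => ((ball_vol n)^-1)%:E * z)).
  by rewrite !muleA -!EFinM mulVf// !mul1e.
rewrite -!ge0_integralZ//; [|by measurability..].
transitivity (\int[lam n]_x \int[lam n]_y (F (O x) * b (addt (O x) y))).
  apply: eq_integral => x _; rewrite -Eb -(integral_addt (O x))// muleC.
  by rewrite ge0_integralZ//; measurability.
rewrite tonelli; [|by measurability|by move=> *; exact: mule_ge0].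
transitivity (\int[lam n]_y \int[lam n]_x (F (addt (O x) (scalet (-1) y)) * b x)).
  apply: eq_integral => y _.
  rewrite -(integral_addt (scalet (-1) (O y)) (f := fun x => F (O x) * b (addt (O x) y)));
    [|by measurability|by move=> *; exact: mule_ge0].
  apply: eq_integral => x _.
  have OE : O (addt (scalet (-1) (O y)) x) = addt (O x) (scalet (-1) y).
    by rewrite isomD// isomZ// (isomK iO) addtC.
  rewrite OE addtNK; congr (_ * _).
  by rewrite /b /inball enorm_isom.
rewrite tonelli; [|by measurability|by move=> *; exact: mule_ge0].
transitivity (\int[lam n]_x ((\int[lam n]_y F (scalet (-1) y)) * b x)).
  apply: eq_integral => x _; rewrite muleC.
  rewrite -(integral_addt (scalet (-1) (O x)) (f := fun y => F (scalet (-1) y)));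
    [|by measurability|by []].
  rewrite -ge0_integralZ//; [|by measurability].
  apply: eq_integral => y _; rewrite muleC; congr (_ * F _).
  by apply: eq_from_tnth => i; rewrite !tnth_mktuple; ring.
rewrite [LHS]ge0_integralZ//; last exact: integral_ge0.
by rewrite Eb muleC [RHS]ge0_integralZ//; measurability.
Qed.

(** The identity is an isometry too, so both sides integrate F (- x). *)
Lemma integral_isometry O (F : n.-tuple R -> \bar R) : is_isometry O ->
  measurable_fun setT F -> (forall x, 0 <= F x) ->
  \int[lam n]_x F (O x) = \int[lam n]_x F x.
Proof.
move=> iO mF F0; rewrite (integral_isometry_opp iO)//.
by rewrite -(@integral_isometry_opp id).
Qed.

Lemma reflect_isometry (v : n.-tuple R) : is_isometry (reflect_along v).
Proof.
split.
- move=> x; apply: eq_from_tnth => i.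
  rewrite !tnth_mktuple /reflect_along dotpDr dotpZr.
  have [v0|v0] := eqVneq (dotp v v) 0%R; last by field.
  by rewrite v0 invr0; ring.
- by move=> x y; rewrite dotpDl dotpDr dotpZl dotpZr (dotpC x v); ring.
- by rewrite /reflect_along; measurability.
Qed.

Lemma reflectE (a b : n.-tuple R) : enorm a = enorm b ->
  reflect_along (addt a (scalet (-1) b)) a = b.
Proof.
move=> ab; have {}ab : dotp a a = dotp b b by rewrite -!sqr_enorm ab.
apply: eq_from_tnth => i.
rewrite !(tnth_mktuple, dotpDl, dotpDr, dotpZl, dotpZr) (dotpC b a) ab.
have [v0|v0] := eqVneq (dotp a b) (dotp b b); last first.
  have d0 : (dotp b b - dotp a b != 0)%R by rewrite subr_eq0 eq_sym.
  by field; rewrite -?mulr2n ?(mulrn_eq0, negb_or); move: d0; lra.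
have : dotp (addt a (scalet (-1) b)) (addt a (scalet (-1) b)) = 0%R.
  by rewrite !(dotpDl, dotpDr, dotpZl, dotpZr) (dotpC b a) ab v0; ring.
move=> /dotp_eq0/(_ i); rewrite !tnth_mktuple => h.
by rewrite v0; move: h; set p := tnth a i; set q := tnth b i => h; rewrite h mulr0; lra.
Qed.

Lemma exists_isometry (a b : n.-tuple R) : enorm a = enorm b ->
  exists2 O, is_isometry O & O a = b.
Proof.
move=> ab; exists (reflect_along (addt a (scalet (-1) b))).
  exact: reflect_isometry.
exact: reflectE.
Qed.

End isometry_invariance.

Lemma rotate_to_axis n (a : n.+1.-tuple R) :
  exists2 O, is_isometry O & O a = tcons (enorm a, zerot n).
Proof.
by apply: exists_isometry; rewrite enorm_axis ger0_norm// enorm_ge0.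
Qed.

Lemma le_integral_null d (T : measurableType d) (m : {measure set T -> \bar R})
    (b : T -> bool) (f g : T -> \bar R) :
  measurable_fun setT b -> m [set x | ~~ b x] = 0 ->
  measurable_fun setT f -> measurable_fun setT g ->
  (forall x, 0 <= f x) -> (forall x, 0 <= g x) ->
  (forall x, b x -> f x <= g x) -> \int[m]_x f x <= \int[m]_x g x.
Proof.
move=> mb m0 mf mg f0 g0 fg; apply: ae_ge0_le_integral => //.
exists [set x | ~~ b x]; split => //.
  by apply: measurable_boolset; apply: measurable_neg.
by move=> x /= h; apply/negP => bx; apply: h => _; exact: fg.
Qed.

Lemma eq_integral_null d (T : measurableType d) (m : {measure set T -> \bar R})
    (b : T -> bool) (f g : T -> \bar R) :
  measurable_fun setT b -> m [set x | ~~ b x] = 0 ->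
  measurable_fun setT f -> measurable_fun setT g ->
  (forall x, 0 <= f x) -> (forall x, 0 <= g x) ->
  (forall x, b x -> f x = g x) -> \int[m]_x f x = \int[m]_x g x.
Proof.
move=> mb m0 mf mg f0 g0 fg; apply/le_anti/andP; split;
  by apply: (le_integral_null mb) => // x /fg ->.
Qed.

Lemma lebesgue_point0 (a : R) : a != 0%R ->
  \int[leb]_t (((a * t)%R == 0%R)%:R)%:E = 0.
Proof.
move=> a0; rewrite integral_bool.
  rewrite (_ : [set x | _] = [set 0%R]); first exact: lebesgue_measure_set1.
  by apply/seteqP; split=> x /=; rewrite mulf_eq0 (negbTE a0)/= => /eqP.
by measurability.
Qed.

Lemma integral_itv_indic (a b : R) : (a <= b)%R ->
  \int[leb]_t (((a <= t) && (t <= b))%R%:R)%:E = (b - a)%:E.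
Proof.
move=> ab; rewrite integral_bool; last by measurability.
apply: (etrans (y := @lebesgue_measure R `[a, b]%classic)).
  by congr lebesgue_measure; apply/seteqP; split=> x /=; rewrite in_itv.
rewrite lebesgue_measure_itv/= lte_fin EFinB; case: ltgtP ab => // -> _.
by rewrite subee.
Qed.

(** Once w is rotated to the first axis, each line parallel to that axis meets
    the hyperplane in one point. *)
Lemma hyperplane_null n (w : n.+1.-tuple R) : enorm w != 0%R ->
  lam n.+1 [set v | ~~ (dotp w v != 0%R)] = 0.
Proof.
move=> w0; rewrite -integral_bool; last first.
  by measurability.
have [U iU Uw] := rotate_to_axis w; have mU := isom_meas iU.
rewrite -(integral_isometry iU)//; last first.
  by measurability.
rewrite integral_tcons2//; last first.
  by measurability.
rewrite integral0_eq// => v _.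
rewrite -[RHS](lebesgue_point0 w0); apply: eq_integral => t _.
by rewrite -(isom_dotp iU) Uw dotp_tcons dotp0l addr0 negbK.
Qed.

Lemma origin_null n : lam n.+1 [set v | ~~ (enorm v != 0%R)] = 0.
Proof.
have e0 : enorm (tcons (1%R, zerot n) : n.+1.-tuple R) != 0%R.
  by rewrite enorm_axis normr1 oner_neq0.
apply/eqP; rewrite -measure_le0 -(hyperplane_null e0).
apply: le_measure; rewrite ?inE; [| |].
- by apply: measurable_boolset; measurability.
- by apply: measurable_boolset; measurability.
- move=> v /=; rewrite !negbK => /eqP v0; apply/eqP.
  have := sqr_enorm v; rewrite v0 expr0n/= => /esym/dotp_eq0 h.
  by rewrite /dotp big1// => i _; rewrite h mulr0.
Qed.

Lemma head_null n : lam n.+1 [set v | ~~ ((tuncons v).1 != 0%R)] = 0.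
Proof.
have e0 : enorm (tcons (1%R, zerot n) : n.+1.-tuple R) != 0%R.
  by rewrite enorm_axis normr1 oner_neq0.
rewrite -(hyperplane_null e0); congr (lam n.+1 _).
apply/seteqP; split=> v /=; rewrite -{1 2}[v]tunconsK; case: (tuncons v) => s w;
  by rewrite dotp_tcons dotp0l addr0 mul1r.
Qed.

End lebesgue_tuple_theory.

(** * The Haar integral of the multiplicative group *)

Section haar_line.
Context {R : realType}.
Local Open Scope ereal_scope.
Notation leb := (@lebesgue_measure R).
Implicit Types f g : R -> \bar R.

(** The Haar integral dt / |t| of the multiplicative group; the origin has
    weight 0 because 0^-1 = 0. *)
Definition mul_haar f : \bar R := \int[leb]_t ((`|t|^-1)%:E * f t).

Lemma mul_haar_scale (s : R) f : s != 0%R ->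
  measurable_fun setT f -> (forall t, 0 <= f t) ->
  mul_haar (fun t => f (s * t)%R) = mul_haar f.
Proof.
move=> s0 mf f0; rewrite /mul_haar.
pose h t : \bar R := (`|t|^-1)%:E * f t.
have h0 t : 0 <= h t by rewrite mule_ge0// lee_fin invr_ge0.
have mh : measurable_fun setT h by rewrite /h; measurability.
have ns : (`|s| != 0)%R by rewrite normr_eq0.
transitivity (\int[leb]_t (`|s|%:E * h (s * t + 0)%R)).
  apply: eq_integral => t _; rewrite /h addr0 muleA -EFinM; congr (_%:E * _).
  by rewrite normrM invfM mulrA divff// mul1r.
rewrite ge0_integralZ//; last by measurability.
by rewrite ge0_integral_affine// muleA -EFinM divff// mul1e.
Qed.

(** dt / |t| is invariant under inversion, by uniqueness of Haar measure: with
    rho the indicator of [1, 2], both sides of the identity times mul_haar rho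
    are double integrals of f (t) rho (s t). *)
Lemma mul_haar_inv f : measurable_fun setT f -> (forall t, 0 <= f t) ->
  mul_haar (fun t => f t^-1%R) = mul_haar f.
Proof.
move=> mf f0.
pose rho (t : R) : \bar R := (((1 <= t) && (t <= 2))%R%:R)%:E.
have rho0 t : 0 <= rho t by rewrite lee_fin.
have mrho : measurable_fun setT rho by rewrite /rho; measurability.
have i0 (t : R) : 0 <= (`|t|^-1)%:E by rewrite lee_fin invr_ge0.
have Irho : \int[leb]_t rho t = 1.
  by rewrite integral_itv_indic; [congr EFin|]; lra.
have [c c0 Ec] : exists2 c : R, (0 < c)%R & mul_haar rho = c%:E.
  have mi : measurable_fun setT (fun t : R => (`|t|^-1)%:E * rho t).
    by measurability.
  have ub : mul_haar rho <= 1.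
    rewrite -Irho; apply: le_integral_ge0 => // [t|t]; first exact: mule_ge0.
    rewrite /rho; case: andP => [[t1 _]|_]; last by rewrite mule0.
    by rewrite mule1 lee_fin invf_le1 ?ger0_norm//; lra.
  have lb : (2^-1)%:E <= mul_haar rho.
    rewrite -[(2^-1)%:E]mule1 -Irho -ge0_integralZ ?lee_fin ?invr_ge0//.
    apply: le_integral_ge0 => // [||t]; first by measurability.
      by move=> t; rewrite mule_ge0// lee_fin invr_ge0.
    rewrite /rho; case: andP => [[t1 t2]|_]; last by rewrite !mule0.
    by rewrite !mule1 lee_fin lef_pV2 ?posrE ?ger0_norm//; lra.
  have fin : mul_haar rho \is a fin_num.
    by rewrite ge0_fin_numE ?(le_lt_trans ub) ?ltry//; apply: le_trans lb; rewrite lee_fin invr_ge0.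
  exists (fine (mul_haar rho)); last by rewrite fineK.
  by rewrite -lte_fin fineK//; apply: lt_le_trans lb; rewrite lte_fin invr_gt0.
suff : c%:E * mul_haar (fun t => f t^-1%R) = c%:E * mul_haar f.
  move/(congr1 (fun z => (c^-1)%:E * z)).
  by rewrite !muleA -!EFinM mulVf ?gt_eqF// !mul1e.
have mf' : measurable_fun setT (fun t : R => f t^-1%R) by measurability.
apply/esym; rewrite -Ec.
transitivity (\int[leb]_t \int[leb]_s ((`|t|^-1)%:E * (`|s|^-1)%:E * (f t * rho (t * s)%R))).
  rewrite /mul_haar -[in LHS]ge0_integralZ//; last 3 first.
  - by measurability.
  - by move=> t; exact: mule_ge0.
  - by apply: integral_ge0 => t _; exact: mule_ge0.
  apply: eq_integral => t _; have [->|t0] := eqVneq t 0%R.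
    rewrite normr0 invr0 mul0e mule0 integral0_eq// => s _.
    by rewrite !mul0e.
  rewrite -[X in X * _ = _](mul_haar_scale t0)// /mul_haar muleC.
  rewrite -ge0_integralZ//; last 3 first.
  - by measurability.
  - by move=> s; exact: mule_ge0.
  - exact: mule_ge0.
  by apply: eq_integral => s _; rewrite muleACA.
rewrite tonelli; last 2 first.
- by measurability.
- by move=> s t; rewrite mule_ge0// mule_ge0.
transitivity (\int[leb]_s \int[leb]_t ((`|t|^-1)%:E * (`|s|^-1)%:E * (f (t / s)%R * rho t))).
  apply: eq_integral => s _; have [->|s0] := eqVneq s 0%R.
    by apply: eq_integral => t _; rewrite normr0 invr0 mule0 !mul0e.
  have := @mul_haar_scale s (fun t => (`|s|^-1)%:E * (f (t / s)%R * rho t)) s0.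
  rewrite /mul_haar => H.
  transitivity (\int[leb]_t ((`|t|^-1)%:E * ((`|s|^-1)%:E * (f (s * t / s)%R * rho (s * t)%R)))).
    apply: eq_integral => t _; rewrite -muleA; congr (_ * (_ * (f _ * rho _))).
      by rewrite mulrC mulKf.
    exact: mulrC.
  rewrite H; last 2 first.
  - by measurability.
  - by move=> t; rewrite mule_ge0// mule_ge0.
  by apply: eq_integral => t _; rewrite -muleA.
rewrite tonelli; last 2 first.
- by measurability.
- by move=> s t; rewrite mule_ge0// mule_ge0.
transitivity (\int[leb]_t (mul_haar (fun t => f t^-1%R) * ((`|t|^-1)%:E * rho t))).
  apply: eq_integral => t _; have [->|t0] := eqVneq t 0%R.
    rewrite normr0 invr0 mul0e mule0 integral0_eq// => s _.
    by rewrite !mul0e.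
  have tV : (t^-1 != 0)%R by rewrite invr_eq0.
  rewrite -(mul_haar_scale tV)// /mul_haar muleC.
  rewrite -ge0_integralZ//; last 3 first.
  - by measurability.
  - by move=> s; exact: mule_ge0.
  - exact: mule_ge0.
  apply: eq_integral => s _.
  rewrite invfM invrK -!muleA; congr (_ * _).
  by rewrite [RHS]muleC muleA.
rewrite ge0_integralZ//; last 3 first.
- by measurability.
- by move=> t; exact: mule_ge0.
- by apply: integral_ge0 => t _; exact: mule_ge0.
by rewrite muleC.
Qed.

(** The substitution t -> c / t preserves dt / |t|. *)
Lemma mul_haar_div (c : R) f g : c != 0%R ->
  measurable_fun setT f -> measurable_fun setT g ->
  (forall t, 0 <= f t) -> (forall t, 0 <= g t) ->
  mul_haar (fun t => f t * g (c / t)%R) = mul_haar (fun t => g t * f (c / t)%R).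
Proof.
move=> c0 mf mg f0 g0.
have cV : (c^-1 != 0)%R by rewrite invr_eq0.
rewrite -mul_haar_inv; last 2 first.
- by measurability.
- by move=> t; exact: mule_ge0.
rewrite -(mul_haar_scale cV); last 2 first.
- by measurability.
- by move=> t; exact: mule_ge0.
congr mul_haar; apply/funext => t; rewrite muleC invrK invfM invrK.
by rewrite mulrA mulfV// mul1r.
Qed.

End haar_line.

(** * Integration over hyperplanes *)

Section hyperplane_integral.
Context {R : realType}.
Local Open Scope ereal_scope.
Notation leb := (@lebesgue_measure R).
Notation lam n := (lebesgue_tuple R n).

(** The integral of f (y) delta (w . y - c) over R^(n+1), computed by solving
    w . y = c for the first coordinate of y. *)
Definition hyper_int n (f : n.+1.-tuple R -> \bar R) (w : n.+1.-tuple R) (c : R)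
    : \bar R :=
  (`|(tuncons w).1|^-1)%:E *
  \int[lam n]_v f (tcons ((c - dotp (tuncons w).2 v) / (tuncons w).1, v)%R).

Section theory.
Variable n : nat.
Implicit Types f g : n.+1.-tuple R -> \bar R.

Lemma hyper_int_tcons f s (w : n.-tuple R) c : hyper_int f (tcons (s, w)) c =
  (`|s|^-1)%:E * \int[lam n]_v f (tcons ((c - dotp w v) / s, v)%R).
Proof. by rewrite /hyper_int tconsK. Qed.

Lemma hyper_int_ge0 f w c : (forall x, 0 <= f x) -> 0 <= hyper_int f w c.
Proof.
by move=> f0; rewrite mule_ge0 ?lee_fin ?invr_ge0//; apply: integral_ge0.
Qed.

Lemma measurable_hyper_int d (T : measurableType d) f
    (g : T -> n.+1.-tuple R) (c : T -> R) :
  measurable_fun setT f -> (forall x, 0 <= f x) ->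
  measurable_fun setT g -> measurable_fun setT c ->
  measurable_fun setT (fun z => hyper_int f (g z) (c z)).
Proof.
move=> mf f0 mg mc; rewrite /hyper_int; measurability.
by apply: measurable_int1 => //; measurability.
Qed.

(** R^(n+1) is sliced by the hyperplanes w . y = c, the first coordinate of y
    being replaced by c. *)
Lemma integral_hyper_int f (g : R -> \bar R) (w : n.+1.-tuple R) :
  (tuncons w).1 != 0%R ->
  measurable_fun setT f -> (forall x, 0 <= f x) ->
  measurable_fun setT g -> (forall x, 0 <= g x) ->
  \int[lam n.+1]_y (f y * g (dotp w y)) = \int[leb]_c (g c * hyper_int f w c).
Proof.
rewrite -[w]tunconsK; case: (tuncons w) => s u; rewrite tconsK /= => s0 mf f0 mg g0.
rewrite integral_tcons2; last 2 first.
- by measurability.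
- by move=> x; exact: mule_ge0.
have is0 : 0 <= (`|s|^-1)%:E by rewrite lee_fin invr_ge0.
transitivity (\int[lam n]_v \int[leb]_c ((`|s|^-1)%:E *
    (f (tcons ((c - dotp u v) / s, v)%R) * g c))).
  apply: eq_integral => v _; rewrite [RHS]ge0_integralZ//; last 2 first.
  - by measurability.
  - by move=> x; exact: mule_ge0.
  rewrite -(ge0_integral_affine (dotp u v) s0
    (f := fun c => f (tcons ((c - dotp u v) / s, v)%R) * g c)); last 2 first.
  - by measurability.
  - by move=> x; exact: mule_ge0.
  apply: eq_integral => t _; rewrite dotp_tcons addrK.
  by rewrite [(s * t)%R]mulrC mulfK.
rewrite tonelli; last 2 first.
- by measurability.
- by move=> *; rewrite mule_ge0// mule_ge0.
apply: eq_integral => c _.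
rewrite hyper_int_tcons muleCA [LHS]ge0_integralZ//; last 2 first.
- by measurability.
- by move=> *; rewrite mule_ge0.
congr (_ * _); rewrite -ge0_integralZ//; last by measurability.
by apply: eq_integral => v _; rewrite muleC.
Qed.

(** Translating by x moves the hyperplane through the origin to the parallel one
    through x. *)
Lemma hyper_int_translate f (w x : n.+1.-tuple R) : (tuncons w).1 != 0%R ->
  measurable_fun setT f -> (forall x, 0 <= f x) ->
  hyper_int f w (dotp w x) = hyper_int (fun y => f (addt x y)) w 0.
Proof.
rewrite -[w]tunconsK; case: (tuncons w) => s u; rewrite tconsK /= => s0 mf f0.
rewrite -[x]tunconsK; case: (tuncons x) => t v.
rewrite !hyper_int_tcons dotp_tcons; congr (_ * _).
rewrite -(integral_addt v)//; last by measurability.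
apply: eq_integral => y _; rewrite addt_tcons; congr (f (tcons (_, _))).
by rewrite dotpDr; field.
Qed.

Definition proj_orth m (y z : m.-tuple R) : m.-tuple R :=
  addt z (scalet (- (dotp y z / dotp y y)) y).

Lemma measurable_proj_orth m (y : m.-tuple R) : measurable_fun setT (proj_orth y).
Proof. by rewrite /proj_orth; measurability. Qed.

(** Integrating over all hyperplanes 0 <= y . z <= 1 instead of a single one
    removes the privileged first coordinate from the formula. *)
Lemma hyper_int_slab f (y : n.+1.-tuple R) : (tuncons y).1 != 0%R ->
  measurable_fun setT f -> (forall x, 0 <= f x) ->
  hyper_int f y 0 = \int[lam n.+1]_z
    (f (proj_orth y z) * (((0 <= dotp y z) && (dotp y z <= 1))%R%:R)%:E).
Proof.
move=> y0 mf f0; have mP := measurable_proj_orth y.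
rewrite (integral_hyper_int (f := f \o proj_orth y)
  (g := fun c => (((0 <= c) && (c <= 1))%R%:R)%:E))//; last 3 first.
- by measurability.
- by move=> x; exact: f0.
- by measurability.
have yy : (dotp y y != 0)%R.
  apply/negP => /eqP/dotp_eq0/(_ ord0) h.
  by move: y0; rewrite /tuncons/= -[thead y]/(tnth y ord0) h eqxx.
transitivity (\int[leb]_c (hyper_int f y 0 * (((0 <= c) && (c <= 1))%R%:R)%:E)).
  rewrite ge0_integralZ//; last 2 first.
  - by measurability.
  - exact: hyper_int_ge0.
  by rewrite integral_itv_indic ?ler01// subr0 mule1.
apply: eq_integral => c _; rewrite muleC; congr (_ * _).
have cE : c = dotp y (scalet (c / dotp y y) y) by rewrite dotpZr divfK.
rewrite [in RHS]cE hyper_int_translate//; last 2 first.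
- by measurability.
- by move=> x; exact: f0.
move: y0 yy {cE mP}; rewrite -[y]tunconsK; case: (tuncons y) => s u.
rewrite tconsK/= => s0 yy.
rewrite !hyper_int_tcons; congr (_ * _); apply: eq_integral => v _ /=; congr f.
apply: eq_from_tnth => i; rewrite !tnth_mktuple !(dotpDr, dotpZr).
have -> : (dotp (tcons (s, u)) (tcons ((0 - dotp u v) / s, v)) = 0)%R.
  by rewrite dotp_tcons; field.
by move: yy => /=; set D := dotp _ _ => yy; field.
Qed.

(** The slab formula is invariant under isometries, so the integral can be
    computed in a frame whose first axis is spanned by y. *)
Lemma hyper_int_isometry f (y : n.+1.-tuple R) U : (tuncons y).1 != 0%R ->
  measurable_fun setT f -> (forall x, 0 <= f x) ->
  is_isometry U -> U y = tcons (enorm y, zerot n) ->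
  hyper_int f y 0 =
  ((enorm y)^-1)%:E * \int[lam n]_v f (U (tcons (0, v)%R)).
Proof.
move=> y0 mf f0 iU Uy; have mU := isom_meas iU.
have mP := measurable_proj_orth y.
rewrite hyper_int_slab// -(integral_isometry iU); last 2 first.
- by measurability.
- by move=> x; rewrite mule_ge0// lee_fin.
rewrite integral_tcons2; last 2 first.
- by measurability.
- by move=> x; rewrite mule_ge0// lee_fin.
have y1 : (0 < enorm y)%R.
  rewrite lt_neqAle enorm_ge0 andbT eq_sym; apply/negP => /eqP e0.
  have := sqr_enorm y; rewrite e0 expr0n/= => /esym/dotp_eq0/(_ ord0) h.
  by move: y0; rewrite /tuncons/= -[thead y]/(tnth y ord0) h eqxx.
have yy : (dotp y y != 0)%R by rewrite -sqr_enorm expf_neq0// gt_eqF.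
have dE t v : dotp y (U (tcons (t, v))) = (enorm y * t)%R.
  by rewrite -(isom_dotp iU) Uy dotp_tcons dotp0l addr0.
have pE t v : proj_orth y (U (tcons (t, v))) = U (tcons (0%R, v)).
  have yE : y = U (tcons (enorm y, zerot n)) by rewrite -Uy (isomK iU).
  rewrite /proj_orth dE [X in scalet _ X]yE -isomZ// -isomD//; congr U.
  rewrite scalet_tcons addt_tcons -sqr_enorm; congr (tcons (_, _)).
    by field; rewrite gt_eqF.
  by apply: eq_from_tnth => i; rewrite !tnth_mktuple mulr0 addr0.
transitivity (\int[lam n]_v (((enorm y)^-1)%:E * f (U (tcons (0, v)%R)))); last first.
  by rewrite ge0_integralZ ?lee_fin ?invr_ge0 ?enorm_ge0//; measurability.
apply: eq_integral => v _.
transitivity (\int[leb]_t (f (U (tcons (0%R, v))) *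
    (((0 <= enorm y * t + 0) && (enorm y * t + 0 <= 1))%R%:R)%:E)).
  by apply: eq_integral => t _; rewrite pE dE addr0.
rewrite ge0_integralZ//; last by measurability.
rewrite muleC; congr (_ * _).
rewrite (ge0_integral_affine 0 (f := fun t => (((0 <= t) && (t <= 1))%R%:R)%:E));
  [|by rewrite gt_eqF|by measurability|by []].
by rewrite integral_itv_indic ?ler01// subr0 mule1 gtr0_norm.
Qed.

End theory.

(** Both sides are the integral of f (w) g (y) delta (w . y).  With u and v the
    tails of w and y, and t the first coordinate of w, that of y is - u . v / t and
    the measure is dt / |t| du dv; exchanging the roles of w and y is then the
    substitution t -> - u . v / t, legitimate for almost all u and v. *)
Lemma hyper_int_swap n (f g : n.+2.-tuple R -> \bar R) :
  measurable_fun setT f -> (forall x, 0 <= f x) ->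
  measurable_fun setT g -> (forall x, 0 <= g x) ->
  \int[lam n.+2]_w (f w * hyper_int g w 0) =
  \int[lam n.+2]_y (g y * hyper_int f y 0).
Proof.
have main (h k : n.+2.-tuple R -> \bar R) :
    measurable_fun setT h -> (forall x, 0 <= h x) ->
    measurable_fun setT k -> (forall x, 0 <= k x) ->
    \int[lam n.+2]_w (h w * hyper_int k w 0) =
    \int[lam n.+1]_u \int[lam n.+1]_v
      mul_haar (fun t => h (tcons (t, u)) * k (tcons (- dotp u v / t, v)%R)).
  move=> mh h0 mk k0; rewrite integral_tcons2; last 2 first.
  - by apply: emeasurable_funM => //; apply: measurable_hyper_int; measurability.
  - by move=> w; rewrite mule_ge0// hyper_int_ge0.
  apply: eq_integral => u _; rewrite /mul_haar [RHS]tonelli; last 2 first.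
  - by measurability.
  - by move=> v t; rewrite mule_ge0 ?lee_fin ?invr_ge0// mule_ge0.
  apply: eq_integral => t _; rewrite hyper_int_tcons.
  rewrite [RHS]ge0_integralZ; last 3 first.
  - by measurability.
  - by move=> v; exact: mule_ge0.
  - by rewrite lee_fin invr_ge0.
  rewrite ge0_integralZ//; last by measurability.
  rewrite muleCA; congr (_ * (_ * _)); apply: eq_integral => v _.
  by rewrite sub0r.
move=> mf f0 mg g0; rewrite (main f g mf f0 mg g0) (main g f mg g0 mf f0).
have mJ (h k : n.+2.-tuple R -> \bar R) :
    measurable_fun setT h -> (forall x, 0 <= h x) ->
    measurable_fun setT k -> (forall x, 0 <= k x) ->
    measurable_fun setT (fun z : n.+1.-tuple R * n.+1.-tuple R =>
      mul_haar (fun t => h (tcons (t, z.1)) * k (tcons (- dotp z.1 z.2 / t, z.2)%R))).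
  move=> mh h0 mk k0; apply: measurable_int1; first by measurability.
  by move=> z t; rewrite mule_ge0 ?lee_fin ?invr_ge0// mule_ge0.
have J0 (h k : n.+2.-tuple R -> \bar R) :
    (forall x, 0 <= h x) -> (forall x, 0 <= k x) -> forall u v : n.+1.-tuple R, 0 <=
      mul_haar (fun t => h (tcons (t, u)) * k (tcons (- dotp u v / t, v)%R)).
  move=> h0 k0 u v; apply: integral_ge0 => t _.
  by rewrite mule_ge0 ?lee_fin ?invr_ge0// mule_ge0.
rewrite [RHS]tonelli; last 2 first.
- exact: mJ.
- exact: J0.
have mswap : measurable_fun setT
    (fun z : n.+1.-tuple R * n.+1.-tuple R => (z.2, z.1)).
  by measurability.
apply: (eq_integral_null (b := fun u => enorm u != 0%R)).
- by measurability.
- exact: origin_null.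
- by apply: measurable_int1; [exact: mJ|exact: J0].
- apply: measurable_int1; last by move=> u v; exact: J0.
  exact: (measurableT_comp (mJ _ _ mg g0 mf f0) mswap).
- by move=> u; apply: integral_ge0 => v _; exact: J0.
- by move=> u; apply: integral_ge0 => v _; exact: J0.
move=> u u0; apply: (eq_integral_null (b := fun v => dotp u v != 0%R)).
- by measurability.
- exact: hyperplane_null.
- apply: (measurableT_comp (mJ _ _ mf f0 mg g0) (_ : measurable_fun setT (fun v => (u, v)))).
  by measurability.
- apply: (measurableT_comp (mJ _ _ mg g0 mf f0) (_ : measurable_fun setT (fun v => (v, u)))).
  by measurability.
- by move=> v; exact: J0.
- by move=> v; exact: J0.
move=> v uv; rewrite [dotp v u]dotpC.
rewrite (mul_haar_div (f := fun t => f (tcons (t, u))) (g := fun t => g (tcons (t, v))))//.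
- by rewrite oppr_eq0.
- by measurability.
- by measurability.
Qed.

End hyperplane_integral.

(** * The volume of a sector of the ball *)

Section sector.
Context {R : realType}.
Local Open Scope ereal_scope.
Notation leb := (@lebesgue_measure R).
Notation lam n := (lebesgue_tuple R n).

(** The squares of the radii of the shells below are explicit, unlike the radii. *)
Lemma exprB_le_sqrB (n : nat) (r s : R) : (2 <= n)%N ->
  (0 <= s)%R -> (s <= r)%R -> (r <= 1)%R ->
  (r ^+ n - s ^+ n <= n%:R * (r ^+ 2 - s ^+ 2))%R.
Proof.
move=> + s0 sr r1; have r0 : (0 <= r)%R by exact: le_trans sr.
have D0 : (0 <= r ^+ 2 - s ^+ 2)%R by rewrite subr_ge0 lerXn2r.
elim: n => // n IH; rewrite leq_eqVlt => /predU1P[<-|]; first by lra.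
rewrite ltnS => n2; have {IH} := IH n2.
have sn : (s ^+ n <= s)%R by rewrite -[leRHS]expr1 ler_wiXn2l//; [lra|exact: ltnW].
have sn0 : (0 <= s ^+ n)%R by exact: exprn_ge0.
have -> : (r ^+ n.+1 - s ^+ n.+1 = r * (r ^+ n - s ^+ n) + s ^+ n * (r - s))%R.
  by rewrite !exprS; ring.
have rn : (0 <= r ^+ n - s ^+ n)%R by rewrite subr_ge0 lerXn2r.
rewrite -(natr1 n); set N := n%:R; nra.
Qed.

(** Scaling fixes the volume of balls, hence of shells. *)
Lemma measure_shell n (s r : R) : (2 <= n)%N ->
  (0 <= s)%R -> (s <= r)%R -> (r <= 1)%R ->
  lam n [set v | ((s <= enorm v) && (enorm v < r))%R] <=
  (n%:R * ball_vol n * (r ^+ 2 - s ^+ 2))%:E.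
Proof.
move=> n2 s0 sr r1.
have mb (t : R) : measurable_fun setT (fun v : n.-tuple R => (enorm v < t)%R).
  by measurability.
have mB t : measurable [set v : n.-tuple R | (enorm v < t)%R].
  exact: measurable_boolset.
pose o := lam n [set v | (enorm v < 1)%R].
have ob : o <= (ball_vol n)%:E.
  rewrite -ball_volE /o; apply: le_measure; rewrite ?inE//.
    by apply: measurable_boolset; measurability.
  by move=> v /=; exact: ltW.
have of_ : o \is a fin_num.
  by rewrite ge0_fin_numE ?measure_ge0// (le_lt_trans ob) ?ltry.
have oE (t : R) : (0 <= t)%R -> lam n [set v | (enorm v < t)%R] = (t ^+ n)%:E * o.
  rewrite le_eqVlt => /predU1P[<-|t0].
    rewrite expr0n; case: n n2 {mb mB ob of_} @o => // n _ o /=; rewrite mul0e.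
    rewrite -[RHS](@measure0 _ _ _ (lam n.+1)); congr (lam n.+1 _).
    by apply/seteqP; split=> v //=; rewrite ltNge enorm_ge0.
  have := @integral_scalet R n t^-1 (fun x => ((enorm x < 1)%R%:R)%:E).
  rewrite invr_eq0 gt_eqF// => /(_ isT).
  rewrite (integral_bool _ (mb 1%R)) gtr0_norm ?invr_gt0// invrK => <-//.
    rewrite -(integral_bool _ (mb t)); apply: eq_integral => x _.
    by rewrite enorm_scalet gtr0_norm ?invr_gt0// mulrC ltr_pdivrMr// mul1r.
  by measurability.
have E : [set v : n.-tuple R | (enorm v < r)%R] =
    [set v | (enorm v < s)%R] `|` [set v | ((s <= enorm v) && (enorm v < r))%R].
  apply/seteqP; split=> v /=.
    by move=> vr; case: (ltP (enorm v) s) => h; [left|right; rewrite vr].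
  by case=> [h|/andP[]//]; exact: lt_le_trans sr.
have mS : measurable [set v : n.-tuple R | ((s <= enorm v) && (enorm v < r))%R].
  by apply: measurable_boolset; measurability.
have h : (s ^+ n)%:E * o + lam n [set v | ((s <= enorm v) && (enorm v < r))%R] =
    (r ^+ n)%:E * o.
  rewrite -(oE s s0) -(oE r (le_trans s0 sr)) E; apply/esym/measureU => //.
  by apply/seteqP; split=> v //= -[h /andP[]]; rewrite leNgt h.
move: h; rewrite -(fineK of_) -!EFinM.
set S := lam n _ => h.
have Sf : S \is a fin_num.
  rewrite fin_numE; apply/andP; split; apply/negP => /eqP Se; move: h; rewrite Se//.
rewrite -(fineK Sf) -EFinD in h; case: h => h.
rewrite -(fineK Sf) lee_fin.
have ob' : (fine o <= ball_vol n)%R by rewrite -lee_fin fineK.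
have o0 : (0 <= fine o)%R by rewrite fine_ge0// measure_ge0.
have := exprB_le_sqrB n2 s0 sr r1; move: h.
have D0 : (0 <= r ^+ 2 - s ^+ 2)%R by rewrite subr_ge0 lerXn2r// ?nnegrE//; exact: le_trans sr.
have : (0 <= n%:R * (r ^+ 2 - s ^+ 2))%R by rewrite mulr_ge0.
set N : R := n%:R; set D := (r ^+ 2 - s ^+ 2)%R; set X := (r ^+ n)%R; set Y := (s ^+ n)%R.
move=> ND h hX.
have : ((N * D) * fine o <= (N * D) * ball_vol n)%R by rewrite ler_wpM2l.
have : ((X - Y) * fine o <= (N * D) * fine o)%R by rewrite ler_wpM2r.
lra.
Qed.

Definition sector n (a b : R) (z : n.+1.-tuple R) : bool :=
  ((enorm z <= 1) && ((a * enorm z < (tuncons z).1) &&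
                      ((tuncons z).1 <= b * enorm z)))%R.

Definition sector_const n : R := ((2 * n%:R + 1) * ball_vol n)%R.

Lemma sector_const_ge0 n : (0 <= sector_const n)%R.
Proof. by rewrite mulr_ge0 ?ball_vol_ge0// addr_ge0// mulr_ge0. Qed.

Lemma measurable_sector n a b : measurable_fun setT (@sector n a b).
Proof. by rewrite /sector; measurability. Qed.

(** Slicing along the axis: the slice at height t is a shell of area at most a
    multiple of (b - a) / a for t <= a, of area at most ball_vol for
    a <= t <= b, and empty above b.  The exponent in the area of a shell being at
    least 2 is what makes the first bound linear in b - a. *)
Lemma sector_pos n (a b : R) : (2 <= n)%N -> (a < b)%R ->
  \int[lam n.+1]_z (((0 < (tuncons z).1)%R && sector a b z)%:R)%:E <=
  (sector_const n * (b - a))%:E.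
Proof.
move=> n2 ab; have ms := @measurable_sector n a b.
rewrite integral_tcons//; last by measurability.
have v0 := @ball_vol_ge0 R n.
have slice_ball t : \int[lam n]_v
    (((0 < (tuncons (tcons (t, v))).1)%R && sector a b (tcons (t, v)))%:R)%:E
    <= (ball_vol n)%:E.
  rewrite -ball_volE -integral_bool; last by measurability.
  apply: le_integral_ge0 => //; first by measurability.
    by measurability.
  move=> v; rewrite lee_fin ler_nat.
  case: (boolP (inball 1 v)) => [_|h]; first by rewrite leq_b1.
  rewrite leqn0 eqb0; apply/negP => /andP[_ /andP[z1 _]]; move: h => /negP; apply.
  rewrite /inball; apply: le_trans z1.
  rewrite -(@ler_pXn2r _ 2)// ?nnegrE ?enorm_ge0// enorm_tcons.
  by rewrite lerDr sqr_ge0.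
have slice_0 t : ~~ ((0 < t) && (t <= b))%R -> \int[lam n]_v
    (((0 < (tuncons (tcons (t, v))).1)%R && sector a b (tcons (t, v)))%:R)%:E = 0.
  move=> h; apply: integral0_eq => v _; apply/eqP; rewrite eqe pnatr_eq0 eqb0.
  apply: contra h; rewrite /sector tconsK /= => /andP[t0 /and3P[z1 _ tb]].
  rewrite t0/=; apply: (le_trans tb).
  have [b0|b0] := leP 0%R b; first by rewrite ler_piMr.
  have : (b * enorm (tcons (t, v)) <= 0)%R by rewrite nmulr_rle0// enorm_ge0.
  by move=> /(le_trans tb); rewrite leNgt t0.
have [a0|a0] := leP a 0%R.
  apply: (@le_trans _ _ (\int[leb]_t
    ((ball_vol n)%:E * (((0 <= t) && (t <= Num.max 0 b))%R%:R)%:E))).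
    apply: le_integral_ge0.
    - by apply: measurable_int1 => //; measurability.
    - by measurability.
    - by move=> t; apply: integral_ge0.
    - move=> t; case: (boolP ((0 < t) && (t <= b))%R) => h.
        have -> : ((0 <= t) && (t <= Num.max 0 b))%R.
          by case/andP: h => t0 tb; rewrite ltW//= le_max tb orbT.
        by rewrite mule1; exact: slice_ball.
      by rewrite slice_0// mule_ge0 ?lee_fin.
  rewrite ge0_integralZ//; last by measurability.
  rewrite integral_itv_indic ?le_max ?lexx// subr0 -EFinM lee_fin.
  rewrite /sector_const.
  have n0 : (0 <= n%:R :> R)%R by [].
  have : (Num.max 0 b <= b - a)%R by rewrite ge_max; apply/andP; split; lra.
  have : (0 <= Num.max 0 b)%R by rewrite le_max lexx.
  set M := (X in (0 <= X)%R); set N := n%:R in n0 *; set V := ball_vol n in v0 * => M0 Mb.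
  apply: (@le_trans _ _ (V * (b - a)))%R; first by rewrite ler_wpM2l.
  rewrite ler_wpM2r ?ler_peMl//; lra.
have b0 : (0 < b)%R by exact: lt_trans ab.
have slice_shell t : (0 < t)%R -> (t < a)%R -> \int[lam n]_v
    (((0 < (tuncons (tcons (t, v))).1)%R && sector a b (tcons (t, v)))%:R)%:E
    <= (n%:R * ball_vol n * (2 * (b - a) / a))%:E.
  move=> t0 ta.
  (* At height t the sector is the shell p <= |v|^2 < q. *)
  pose q := (t ^+ 2 / a ^+ 2 - t ^+ 2)%R; pose p := (t ^+ 2 / b ^+ 2 - t ^+ 2)%R.
  have t2a : (t ^+ 2 / a ^+ 2 <= 1)%R.
    by rewrite ler_pdivrMr ?exprn_gt0// mul1r lerXn2r// ?nnegrE; lra.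
  have i1 : (a ^- 2 - b ^- 2 = (b - a) * (b + a) / (a ^+ 2 * b ^+ 2))%R.
    by field; rewrite !gt_eqF.
  have pq : (p <= q)%R.
    rewrite -subr_ge0 (_ : q - p = t ^+ 2 * (a ^- 2 - b ^- 2))%R; last by rewrite /p /q; ring.
    by rewrite i1 mulr_ge0 ?sqr_ge0// !mulr_ge0 ?invr_ge0 ?mulr_ge0 ?sqr_ge0//; lra.
  have q1 : (q <= 1)%R by have := sqr_ge0 t; rewrite /q; lra.
  have sq1 : (Num.sqrt q <= 1)%R by rewrite -sqrtr1 ler_wsqrtr.
  apply: (@le_trans _ _ (lam n [set v | ((Num.sqrt p <= enorm v) && (enorm v < Num.sqrt q))%R])).
    rewrite -integral_bool; last by measurability.
    apply: le_integral_ge0 => //; [by measurability|by measurability|].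
    move=> v; rewrite lee_fin ler_nat.
    case: (boolP (_ && sector _ _ _)) => // /andP[_]; rewrite /sector tconsK /=.
    move=> /and3P[_ az zb]; set z := tcons (t, v) in az zb.
    have z0 : (0 <= enorm z)%R := enorm_ge0 z.
    have zE : (enorm z ^+ 2 = t ^+ 2 + dotp v v)%R by rewrite enorm_tcons sqr_enorm.
    have h1 : (dotp v v < q)%R.
      rewrite /q ltrBrDl -zE ltr_pdivlMr ?exprn_gt0// -exprMn mulrC.
      by rewrite ltrXn2r// ?nnegrE ?mulr_ge0//; lra.
    have h2 : (p <= dotp v v)%R.
      rewrite /p lerBlDl -zE ler_pdivrMr ?exprn_gt0// -exprMn mulrC.
      by rewrite lerXn2r// ?nnegrE ?mulr_ge0//; lra.
    have q0 : (0 < q)%R by apply: le_lt_trans h1; exact: dotp_ge0.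
    by rewrite /enorm ltr_sqrt// h1 ler_wsqrtr.
  apply: (le_trans (measure_shell n2 (sqrtr_ge0 _) (ler_wsqrtr pq) sq1)).
  rewrite lee_fin ler_wpM2l ?mulr_ge0//.
  have d0 : (0 <= 2 * (b - a) / a)%R by rewrite !mulr_ge0 ?invr_ge0//; lra.
  have [q0|q0] := leP q 0%R.
    by rewrite (ler0_sqrtr q0) (ler0_sqrtr (le_trans pq q0)) subrr.
  rewrite (sqr_sqrtr (ltW q0)).
  have sp : (p <= Num.sqrt p ^+ 2)%R.
    have [p0|p0] := leP 0%R p; first by rewrite sqr_sqrtr.
    by apply: (le_trans (ltW p0)); exact: sqr_ge0.
  apply: (@le_trans _ _ (q - p)%R); first by lra.
  rewrite (_ : q - p = (t ^+ 2 / a ^+ 2) * ((b - a) * (b + a) / b ^+ 2))%R; last first.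
    by rewrite /p /q; field; rewrite !gt_eqF.
  have c0 : (0 <= (b - a) * (b + a) / b ^+ 2)%R.
    by rewrite !mulr_ge0 ?invr_ge0 ?sqr_ge0//; lra.
  apply: (@le_trans _ _ ((b - a) * (b + a) / b ^+ 2)%R); first by rewrite ler_piMl.
  rewrite ler_pdivrMr ?exprn_gt0// (_ : 2 * (b - a) / a * b ^+ 2 =
    (b - a) * (2 * b * (b / a)))%R; last by ring.
  rewrite ler_wpM2l//; first by lra.
  have ba : (1 <= b / a)%R by rewrite ler_pdivlMr// mul1r ltW.
  apply: (@le_trans _ _ (2 * b * 1)%R); first by lra.
  by rewrite ler_wpM2l//; lra.
pose k := (n%:R * ball_vol n * (2 * (b - a) / a))%R.
have k0 : (0 <= k)%R by rewrite !mulr_ge0 ?invr_ge0//; lra.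
apply: (@le_trans _ _ (\int[leb]_t ((ball_vol n)%:E * (((a <= t) && (t <= b))%R%:R)%:E +
   k%:E * (((0 <= t) && (t <= a))%R%:R)%:E))).
  apply: le_integral_ge0.
  - by apply: measurable_int1 => //; measurability.
  - by measurability.
  - by move=> t; apply: integral_ge0.
  - move=> t; case: (boolP ((0 < t) && (t <= b))%R) => h; last first.
      by rewrite slice_0// adde_ge0// mule_ge0 ?lee_fin.
    case/andP: h => t0 tb; have [ta|at_] := ltP t a.
      apply: (le_trans (slice_shell t t0 ta)).
      rewrite (ltW t0) (ltW ta)/= mule1 leeDr// mule_ge0 ?lee_fin//.
    rewrite tb mule1; apply: (le_trans (slice_ball t)).
    by rewrite leeDl// mule_ge0 ?lee_fin.
rewrite ge0_integralD//=; last 4 first.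
- by move=> t _; rewrite mule_ge0 ?lee_fin.
- by measurability.
- by move=> t _; rewrite mule_ge0 ?lee_fin.
- by measurability.
rewrite !ge0_integralZ ?lee_fin//; [|by measurability..].
rewrite (integral_itv_indic (ltW ab)) (integral_itv_indic (ltW a0)).
rewrite subr0 -!EFinM -EFinD lee_fin.
rewrite le_eqVlt; apply/orP; left; apply/eqP.
by rewrite /k /sector_const; field; rewrite gt_eqF.
Qed.

(** The half z_1 < 0 is reflected to the half z_1 > 0.  This exchanges the open
    and closed ends of the interval from a to b, hence the larger interval from
    a - 2 b to - a, of length 2 (b - a). *)
Lemma measure_sector n (a b : R) : (2 <= n)%N -> (a < b)%R ->
  \int[lam n.+1]_z ((sector a b z)%:R)%:E <= (3 * sector_const n * (b - a))%:E.
Proof.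
move=> n2 ab; have ms := @measurable_sector n a b.
have ms' := @measurable_sector n (a - 2 * b) (- a).
pose opp (z : n.+1.-tuple R) := scalet (-1) z.
have mo : measurable_fun setT opp by rewrite /opp; measurability.
have io : is_isometry opp.
  split => //; rewrite /opp.
  - by move=> x; apply: eq_from_tnth => i; rewrite !tnth_mktuple; ring.
  - by move=> x y; rewrite dotpZl dotpZr.
have ab' : (a - 2 * b < - a)%R by lra.
apply: (@le_trans _ _ (\int[lam n.+1]_z
  ((((0 < (tuncons z).1)%R && sector a b z)%:R)%:E +
   (((0 < (tuncons (opp z)).1)%R && sector (a - 2 * b) (- a) (opp z))%:R)%:E))).
  apply: (le_integral_null (b := fun z => (tuncons z).1 != 0%R)).
  - by measurability.
  - exact: head_null.
  - by measurability.
  - by measurability.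
  - by [].
  - by move=> z; rewrite adde_ge0.
  - move=> z z0; rewrite -EFinD lee_fin -natrD ler_nat.
    case: (boolP (sector a b z)) => //; rewrite /sector => /and3P[z1 az zb].
    have zo : (tuncons (opp z)).1 = (- (tuncons z).1)%R.
      by rewrite -{1}[z]tunconsK; case: (tuncons z) => s u; rewrite /opp scalet_tcons tconsK mulN1r.
    have eo : enorm (opp z) = enorm z by exact: enorm_isom.
    have := enorm_ge0 z; rewrite zo eo z1 andbT /=.
    move: z0 az zb; set t := (tuncons z).1; set e := enorm z => z0 az zb e0.
    have [tp|tn] := ltP 0%R t; first by [].
    have {z0 tn} t0 : (t < 0)%R by rewrite lt_neqAle z0.
    have ep : (0 < e)%R.
      rewrite lt_neqAle e0 andbT; apply: contraTneq az => <-.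
      by rewrite mulr0 -leNgt ltW.
    rewrite oppr_gt0 t0/= mulNr lerN2 (ltW az) andbT.
    rewrite mulrBl ltrBlDr; case: ltP => //; rewrite leNgt => /negP; elim.
    suff : (a * e < - t + 2 * b * e)%R by [].
    have : (a * e < b * e)%R by rewrite ltr_pM2r.
    by lra.
rewrite ge0_integralD//; last 2 first.
- by measurability.
- by measurability.
have -> : (3 * sector_const n * (b - a) = sector_const n * (b - a) +
    sector_const n * (- a - (a - 2 * b)))%R by ring.
rewrite EFinD; apply: leeD; first exact: sector_pos.
rewrite (integral_isometry io (F := fun z => (((0 < (tuncons z).1)%R &&
   sector (a - 2 * b) (- a) z)%:R)%:E))//; last by measurability.
exact: sector_pos.
Qed.

End sector.

(** * Bounds on the kernel and on its level sets *)

Section kernel.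
Context {R : realType}.
Local Open Scope ereal_scope.
Notation lam n := (lebesgue_tuple R n).

Definition kernel_const n : R := (ball_vol n.+1 + 3 * sector_const n)%R.

Lemma strip_dist_ge0 d h (x y : d.-tuple R) : (0 <= strip_dist h x y)%R.
Proof. by rewrite le_max enorm_ge0. Qed.

(** In coordinates adapted to y the integral is |y|^-1 times the volume of a
    sector of the unit ball of y^perp about the component of x orthogonal to y.
    That component has length wedge x y / |y|, so the sector has opening
    (b - a) |y| / wedge x y and volume at most a multiple of it. *)
Lemma hyper_int_strip n (a b : R) (x y : n.+2.-tuple R) : (2 <= n)%N ->
  (a < b)%R -> (tuncons y).1 != 0%R ->
  hyper_int (fun w => ((in_strip a b w (dotp x w))%:R)%:E) y 0 <=
  (kernel_const n / strip_dist (b - a) x y)%:E.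
Proof.
move=> n2 ab y0; have [U iU Uy] := rotate_to_axis y.
have mU := isom_meas iU.
rewrite (hyper_int_isometry y0 _ _ iU Uy)//; last first.
  by measurability.
have y1 : (0 < enorm y)%R.
  rewrite lt_neqAle enorm_ge0 andbT eq_sym; apply/negP => /eqP e0.
  have := sqr_enorm y; rewrite e0 expr0n/= => /esym/dotp_eq0/(_ ord0) h.
  by move: y0; rewrite /tuncons/= -[thead y]/(tnth y ord0) h eqxx.
pose xi := (tuncons (U x)).1; pose zeta := (tuncons (U x)).2.
have Ux : U x = tcons (xi, zeta) by rewrite -[LHS]tunconsK /xi /zeta; case: (tuncons _).
have eU v : enorm (U (tcons (0%R, v))) = enorm v.
  rewrite enorm_isom//; apply/eqP; rewrite -(@eqrXn2 _ 2) ?enorm_ge0//.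
  by rewrite enorm_tcons expr0n add0r.
have dU v : dotp x (U (tcons (0%R, v))) = dotp zeta v.
  by rewrite -(isom_dotp iU) Ux dotp_tcons mulr0 add0r.
have xixy : (xi * enorm y = dotp x y)%R.
  rewrite -[y in RHS](isomK iU) -(isom_dotp iU) Uy Ux dotp_tcons dotp0r.
  by rewrite addr0.
have wE : (enorm y * enorm zeta = wedge x y)%R.
  have -> : (enorm y * enorm zeta = Num.sqrt (dotp y y * dotp zeta zeta))%R.
    by rewrite sqrtrM ?dotp_ge0.
  congr Num.sqrt; rewrite -xixy -!sqr_enorm -(enorm_isom iU x) Ux enorm_tcons.
  by ring.
have mb : measurable_fun setT (fun v : n.+1.-tuple R => in_strip a b v (dotp zeta v)).
  by measurability.
have I1 : \int[lam n.+1]_v ((in_strip a b v (dotp zeta v))%:R)%:E <= (ball_vol n.+1)%:E.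
  rewrite -ball_volE -integral_bool; last by measurability.
  apply: le_integral_ge0 => //; first by measurability.
    by measurability.
  move=> v; rewrite lee_fin ler_nat /inball /in_strip.
  by case: (_ < _)%R => //=; case: (_ <= 1)%R => //=; rewrite leq_b1.
have I2 : (0 < enorm zeta)%R ->
    \int[lam n.+1]_v ((in_strip a b v (dotp zeta v))%:R)%:E <=
    (3 * sector_const n * ((b - a) / enorm zeta))%:E.
  move=> z0; have [V iV Vz] := rotate_to_axis zeta; have mV := isom_meas iV.
  rewrite -(integral_isometry iV)//; last by measurability.
  have ab' : (a / enorm zeta < b / enorm zeta)%R by rewrite ltr_pM2r ?invr_gt0.
  rewrite [X in (_ * X)%R%:E]mulrBl.
  apply: le_trans (measure_sector n2 ab').
  have ms := @measurable_sector R n (a / enorm zeta) (b / enorm zeta).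
  apply: le_integral_ge0 => //; [by measurability|by measurability|].
  move=> v; rewrite lee_fin ler_nat /in_strip /sector enorm_isom//.
  have -> : (dotp zeta (V v) = enorm zeta * (tuncons v).1)%R.
    rewrite -(isom_dotp iV) Vz -{1}[v]tunconsK; case: (tuncons v) => s u.
    by rewrite dotp_tcons dotp0l addr0.
  case: (0 < _)%R => //=; case: (_ <= 1)%R => //=.
  rewrite [(a / _ * _)%R]mulrAC [(b / _ * _)%R]mulrAC.
  by rewrite ltr_pdivrMr// ler_pdivlMr// [(_ * enorm zeta)%R]mulrC.
have -> : \int[lam n.+1]_v ((in_strip a b (U (tcons (0%R, v)))
      (dotp x (U (tcons (0%R, v)))))%:R)%:E =
    \int[lam n.+1]_v ((in_strip a b v (dotp zeta v))%:R)%:E.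
  by apply: eq_integral => v _; rewrite /in_strip eU dU.
have iy : (0 <= (enorm y)^-1)%R by rewrite invr_ge0 ltW.
have k1 : (ball_vol n.+1 <= kernel_const n)%R.
  by rewrite lerDl mulr_ge0// sector_const_ge0.
have k2 : (3 * sector_const n <= kernel_const n)%R.
  by rewrite lerDr ball_vol_ge0.
rewrite /strip_dist; case: (leP (enorm y) (wedge x y / (b - a))%R) => h; last first.
  rewrite mulrC EFinM lee_wpmul2l ?lee_fin//; apply: (le_trans I1).
  by rewrite lee_fin.
have w0 : (0 < wedge x y)%R.
  have : (0 < wedge x y / (b - a))%R by exact: lt_le_trans h.
  by rewrite pmulr_lgt0// invr_gt0 subr_gt0.
have z0 : (0 < enorm zeta)%R by rewrite -(pmulr_rgt0 _ y1) wE.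
apply: (@le_trans _ _ ((enorm y)^-1%:E * (3 * sector_const n * ((b - a) / enorm zeta))%:E)).
  by rewrite lee_wpmul2l ?lee_fin// I2.
rewrite -EFinM lee_fin -wE.
rewrite [leLHS](_ : _ = (3 * sector_const n) * ((b - a) / (enorm y * enorm zeta)))%R; last first.
  by field; rewrite !gt_eqF.
rewrite invf_div ler_wpM2r// mulr_ge0 ?invr_ge0 ?mulr_ge0 ?enorm_ge0//.
by rewrite subr_ge0 ltW.
Qed.

(** In a frame whose first axis is spanned by x the set is contained in the
    cylinder of length 2 t and radius h t / |x| about that axis. *)
Lemma measure_strip_ball n (h r t : R) (x : n.+2.-tuple R) :
  (0 < h)%R -> (0 < r)%R -> (r < enorm x)%R -> (0 <= t)%R ->
  \int[lam n.+2]_y (((strip_dist h x y < t)%R%:R)%:E) <=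
  (2 * ball_vol n.+1 * (h / r) ^+ n.+1 * t ^+ n.+2)%:E.
Proof.
move=> h0 r0 rx; rewrite le_eqVlt => /predU1P[<-|t0].
  rewrite integral0_eq => [|y _]; last by rewrite ltNge strip_dist_ge0.
  by rewrite lee_fin expr0n mulr0.
have x0 : (0 < enorm x)%R by exact: lt_trans rx.
have [U iU Ux] := rotate_to_axis x; have mU := isom_meas iU.
have md : measurable_fun setT (fun y : n.+2.-tuple R => (strip_dist h x y < t)%R).
  by measurability.
rewrite -(integral_isometry iU)//; last by measurability.
rewrite integral_tcons//; last by measurability.
pose q := (h * t / r)%R; have q0 : (0 < q)%R by rewrite !mulr_gt0 ?invr_gt0.
have mi : measurable_fun setT (fun v : n.+1.-tuple R => inball q v).
  by measurability.
apply: (@le_trans _ _ (\int[@lebesgue_measure R]_s \int[lam n.+1]_v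
    ((((- t <= s) && (s <= t))%R%:R)%:E * ((inball q v)%:R)%:E))).
  have mF : measurable_fun setT (fun z : measurableTypeR R * n.+1.-tuple R =>
      ((((- t <= z.1) && (z.1 <= t))%R%:R)%:E * ((inball q z.2)%:R)%:E : \bar R)).
    by measurability.
  apply: le_integral_ge0.
  - by apply: measurable_int1 => //; measurability.
  - by apply: measurable_int1 => // s v; rewrite mule_ge0.
  - by move=> s; exact: integral_ge0.
  move=> s; apply: le_integral_ge0 => //; [by measurability|by measurability|].
  move=> v; rewrite -EFinM lee_fin -natrM ler_nat mulnb.
  case: (boolP (_ < _)%R) => //; rewrite /strip_dist gt_max => /andP[yt wt].
  rewrite lt0b -ler_norml /inball.
  have zE : enorm (U (tcons (s, v))) = enorm (tcons (s, v)) by exact: enorm_isom.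
  apply/andP; split.
    apply: le_trans (ltW yt); rewrite zE.
    have := enorm_comp (tcons (s, v)) ord0; by rewrite tnth_tcons0.
  have wE : wedge x (U (tcons (s, v))) = (enorm x * enorm v)%R.
    rewrite -[RHS]ger0_norm ?mulr_ge0 ?enorm_ge0// -sqrtr_sqr; congr Num.sqrt.
    rewrite -!sqr_enorm zE -(isom_dotp iU) Ux dotp_tcons dotp0l addr0 enorm_tcons.
    by ring.
  move: wt; rewrite wE ltr_pdivrMr// => wt.
  rewrite /q ler_pdivlMr// mulrC; apply: le_trans (_ : t * h <= _)%R; last by rewrite mulrC.
  apply: le_trans (ltW wt); rewrite ler_wpM2r ?enorm_ge0//; exact: ltW.
apply: (@le_trans _ _ (\int[@lebesgue_measure R]_s
    ((q ^+ n.+1 * ball_vol n.+1)%:E * (((- t <= s) && (s <= t))%R%:R)%:E))).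
  rewrite le_eqVlt; apply/orP; left; apply/eqP; apply: eq_integral => s _.
  rewrite ge0_integralZ//; last by measurability.
  rewrite muleC; congr (_ * _).
  by apply: etrans (integral_bool _ mi) _; exact: measure_ball.
rewrite ge0_integralZ//; last 2 first.
- by measurability.
- by rewrite lee_fin mulr_ge0 ?ball_vol_ge0// exprn_ge0// ltW.
rewrite integral_itv_indic; last by lra.
rewrite -EFinM lee_fin le_eqVlt; apply/orP; left; apply/eqP.
have -> : q = ((h / r) * t)%R by rewrite /q; ring.
by rewrite exprMn [(t ^+ n.+2)%R]exprS; ring.
Qed.

End kernel.

(** * A bilinear estimate for kernels of weak type *)

Section weak_kernel.
Context {R : realType} d (T : measurableType d).
Local Open Scope ereal_scope.
Variable mu : {sigma_finite_measure set T -> \bar R}.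

Lemma le_nneseries_term (u : nat -> \bar R) k : (forall n, 0 <= u n) ->
  u k <= \sum_(n <oo) u n.
Proof.
move=> u0; apply: (@le_trans _ _ (\sum_(0 <= n < k.+1) u n)).
  by rewrite big_nat_recr//= leeDr// sume_ge0.
exact: nneseries_lim_ge.
Qed.

Variables (k : nat) (A : R).
Hypotheses (k0 : (0 < k)%N) (A0 : (0 < A)%R).

Section pointwise.
Variable m : T -> R.
Hypotheses (mm : measurable_fun setT m) (m0 : forall y, (0 <= m y)%R).
Hypothesis mA : forall t : R, (0 <= t)%R ->
  \int[mu]_y ((m y < t)%R%:R)%:E <= (A * t ^+ k.+1)%:E.

Lemma dyadic_below (r t : R) : (0 < t)%R -> (t < r)%R ->
  exists j, (r / 2 ^+ j.+1 <= t)%R && (t < r / 2 ^+ j)%R.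
Proof.
move=> t0 tr; have r0 : (0 < r)%R by exact: lt_trans tr.
have : exists j, (r / 2 ^+ j.+1 <= t)%R.
  have h := @upper_nthrootP R (r / t) _ (leqnn _).
  exists (Num.bound (r / t)); rewrite ler_pdivrMr ?exprn_gt0//.
  move: h; rewrite ltr_pdivrMr// exprS mulrC => h.
  apply: (le_trans (ltW h)); rewrite ler_wpM2l ?(ltW t0)//.
  by rewrite ler_peMl ?exprn_ge0//; lra.
move=> /ex_minnP[j jt jmin]; exists j; rewrite jt/=.
case: j jt jmin => [|j] jt jmin; first by rewrite expr0 divr1.
by rewrite ltNge; apply/negP => /jmin; rewrite ltnn.
Qed.

Lemma dyadic_above (r t : R) : (0 < r)%R -> (r <= t)%R ->
  exists j, (r * 2 ^+ j <= t)%R && (t < r * 2 ^+ j.+1)%R.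
Proof.
move=> r0 rt.
have : exists j, (t < r * 2 ^+ j.+1)%R.
  have h := @upper_nthrootP R (t / r) _ (leqnn _).
  exists (Num.bound (t / r)); move: h; rewrite ltr_pdivrMr// => h.
  apply: (lt_le_trans h); rewrite mulrC ler_wpM2l ?(ltW r0)// exprS.
  by rewrite ler_peMl ?exprn_ge0//; lra.
move=> /ex_minnP[j jt jmin]; exists j; rewrite jt andbT.
case: j jt jmin => [|j] jt jmin; first by rewrite expr0 mulr1.
by rewrite leNgt; apply/negP => /jmin; rewrite ltnn.
Qed.

(** Summed over the dyadic shells r / 2^(j+1) <= m < r / 2^j, whose measures
    decay faster than 1 / m grows as k > 0. *)
Lemma integral_near (r : R) : (0 < r)%R ->
  \int[mu]_y (((m y < r)%R%:R / m y)%:E) <= (4 * A * r ^+ k)%:E.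
Proof.
move=> r0; have p2 j : (0 < 2 ^+ j :> R)%R by rewrite exprn_gt0.
pose F j y : \bar R := (2 ^+ j.+1 / r)%:E * ((m y < r / 2 ^+ j)%R%:R)%:E.
have F0 j y : 0 <= F j y.
  by rewrite mule_ge0 ?lee_fin// divr_ge0// ltW.
have mF j : measurable_fun setT (F j) by rewrite /F; measurability.
apply: (@le_trans _ _ (\int[mu]_y \sum_(j <oo) F j y)).
  apply: le_integral_ge0.
  - by measurability.
  - by apply: ge0_emeasurable_sum.
  - by move=> y; rewrite lee_fin divr_ge0.
  move=> y; case: (boolP (m y < r)%R) => [mr|_]; last first.
    by rewrite mul0r; apply: nneseries_ge0 => j _ _.
  rewrite mul1r; have [->|my] := eqVneq (m y) 0%R.
    by rewrite invr0; apply: nneseries_ge0 => j _ _.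
  have {}my : (0 < m y)%R by rewrite lt_neqAle eq_sym my m0.
  have [j /andP[j1 j2]] := dyadic_below my mr.
  apply: le_trans (le_nneseries_term j (fun j => F0 j y)).
  rewrite /F j2 mule1 lee_fin -[leRHS]invf_div lef_pV2 ?posrE//.
  by rewrite divr_gt0.
rewrite integral_nneseries//.
have e0 : (0 <= 4 * A * r ^+ k)%R.
  by rewrite !mulr_ge0 ?exprn_ge0// ltW.
apply: (@le_trans _ _ (\sum_(j <oo) ((4 * A * r ^+ k) / (2 ^ j.+1)%:R)%:E)); last first.
  exact: (epsilon_trick0 xpredT).
apply: lee_nneseries => [j _ _|j _].
  exact: integral_ge0.
rewrite ge0_integralZ//; last 2 first.
- by measurability.
- by rewrite lee_fin divr_ge0// ltW.
have rj : (0 <= r / 2 ^+ j)%R by rewrite divr_ge0// ltW.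
apply: (@le_trans _ _ ((2 ^+ j.+1 / r)%:E * (A * (r / 2 ^+ j) ^+ k.+1)%:E)).
  by rewrite lee_wpmul2l ?mA// lee_fin divr_ge0// ltW.
rewrite -EFinM lee_fin natrX.
rewrite [leLHS](_ : _ = 4 * A * r ^+ k / 2 ^+ j.+1 * (2 ^+ j / (2 ^+ j) ^+ k))%R; last first.
  by rewrite expr_div_n !exprS; field; rewrite !expf_neq0// gt_eqF.
rewrite ler_piMr//; first by rewrite divr_ge0// ltW.
rewrite ler_pdivrMr ?exprn_gt0// mul1r -[leLHS]expr1 ler_weXn2l//.
by rewrite exprn_ege1//; lra.
Qed.

(** Summed over the dyadic shells r 2^j <= m < r 2^(j+1). *)
Lemma integral_far (r : R) : (0 < r)%R ->
  \int[mu]_y (((r <= m y)%R%:R / m y ^+ (2 * k.+1))%:E) <=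
  (2 ^+ k.+2 * A / r ^+ k.+1)%:E.
Proof.
move=> r0; have p2 j : (0 < 2 ^+ j :> R)%R by rewrite exprn_gt0.
pose F j y : \bar R := ((r * 2 ^+ j) ^- (2 * k.+1))%:E *
  ((m y < r * 2 ^+ j.+1)%R%:R)%:E.
have c0 j : (0 <= (r * 2 ^+ j) ^- (2 * k.+1))%R.
  by rewrite invr_ge0 exprn_ge0// mulr_ge0// ltW.
have F0 j y : 0 <= F j y by rewrite mule_ge0 ?lee_fin.
have mF j : measurable_fun setT (F j) by rewrite /F; measurability.
apply: (@le_trans _ _ (\int[mu]_y \sum_(j <oo) F j y)).
  apply: le_integral_ge0.
  - by measurability.
  - by apply: ge0_emeasurable_sum.
  - by move=> y; rewrite lee_fin divr_ge0// exprn_ge0.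
  move=> y; case: (boolP (r <= m y)%R) => [mr|_]; last first.
    by rewrite mul0r; apply: nneseries_ge0 => j _ _.
  rewrite mul1r; have [j /andP[j1 j2]] := dyadic_above r0 mr.
  apply: le_trans (le_nneseries_term j (fun j => F0 j y)).
  have pr : (0 < r * 2 ^+ j)%R by rewrite mulr_gt0.
  rewrite /F j2 mule1 lee_fin lef_pV2 ?posrE ?exprn_gt0//; last first.
    exact: lt_le_trans j1.
  by rewrite lerXn2r// ?nnegrE ?(ltW pr).
rewrite integral_nneseries//.
have e0 : (0 <= 2 ^+ k.+2 * A / r ^+ k.+1)%R.
  apply: divr_ge0; last exact/exprn_ge0/ltW.
  by apply: mulr_ge0; [exact: exprn_ge0|exact: ltW].
apply: (@le_trans _ _ (\sum_(j <oo) ((2 ^+ k.+2 * A / r ^+ k.+1) / (2 ^ j.+1)%:R)%:E)); last first.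
  exact: (epsilon_trick0 xpredT).
apply: lee_nneseries => [j _ _|j _].
  exact: integral_ge0.
rewrite ge0_integralZ//; last 2 first.
- by measurability.
- by rewrite lee_fin.
have rj : (0 <= r * 2 ^+ j.+1)%R by rewrite mulr_ge0// ltW.
apply: (@le_trans _ _ (((r * 2 ^+ j) ^- (2 * k.+1))%:E * (A * (r * 2 ^+ j.+1) ^+ k.+1)%:E)).
  by rewrite lee_wpmul2l ?mA// lee_fin.
rewrite -EFinM lee_fin natrX.
rewrite [leLHS](_ : _ = 2 ^+ k.+2 * A / r ^+ k.+1 / 2 ^+ j.+1 *
  (2 ^+ j / (2 ^+ j) ^+ k.+1))%R; last first.
  rewrite mul2n -addnn exprD !exprMn [(2 ^+ j.+1)%R]exprS exprMn [(2 ^+ k.+2)%R]exprS.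
  set X := (2 ^+ k.+1)%R; set Y := ((2 ^+ j) ^+ k.+1)%R; set Z := (r ^+ k.+1)%R.
  by field; rewrite /Y /Z !expf_neq0// gt_eqF.
rewrite ler_piMr//; first by rewrite divr_ge0// ltW.
rewrite ler_pdivrMr ?exprn_gt0// mul1r -[leLHS]expr1 ler_weXn2l//.
by rewrite exprn_ege1//; lra.
Qed.

End pointwise.

Variable m : T -> T -> R.
Hypotheses (mm : measurable_fun setT (fun z => m z.1 z.2))
  (m0 : forall x y, (0 <= m x y)%R) (mC : forall x y, m x y = m y x).
Variable v : T -> R.
Hypotheses (mv : measurable_fun setT v) (v0 : forall x, (0 <= v x)%R).
Hypothesis mA : forall x, (0 < v x)%R -> forall t : R, (0 <= t)%R ->
  \int[mu]_y ((m x y < t)%R%:R)%:E <= (A * t ^+ k.+1)%:E.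
Variable be : R.
Hypotheses (be0 : (0 < be)%R)
  (vE : \int[mu]_x (v x ^+ (2 * k.+1))%:E = (A * be ^+ k.+1)%:E).

Definition weak_const : R := (5 + 2 ^+ k.+2)%R.

(** Young's inequality with a crude constant, by comparing t with s u. *)
Lemma mulXr_le_sum (u s t : R) p : (0 <= u)%R -> (0 < s)%R -> (0 <= t)%R ->
  (u ^+ p * t <= s * u ^+ p.+1 + t ^+ p.+1 / s ^+ p)%R.
Proof.
move=> u0 s0 t0; have [h|h] := leP t (s * u)%R.
  rewrite -[leLHS]addr0 lerD// ?divr_ge0 ?exprn_ge0//; last exact: ltW.
  by rewrite exprSr mulrCA ler_wpM2l ?exprn_ge0.
rewrite -[leLHS]add0r lerD// ?mulr_ge0 ?exprn_ge0// ?(ltW s0)//.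
rewrite ler_pdivlMr ?exprn_gt0// exprSr mulrAC -exprMn.
by rewrite ler_wpM2r// lerXn2r// ?nnegrE ?mulr_ge0 ?(ltW s0)// mulrC ltW.
Qed.

Let msec x : measurable_fun setT (m x).
Proof.
by apply: (measurableT_comp mm (_ : measurable_fun setT (fun y => (x, y)))); measurability.
Qed.

(** Where m is small the bound v (y) <= v (x) suffices; where m is large Young's
    inequality trades the factor v (y)^(2k+1) for v (y)^(2k+2), whose integral is
    known, and for m^-(2k+2), which is integrable there. *)
Lemma integral_smaller x : (0 < v x)%R ->
  \int[mu]_y (((v y <= v x)%R%:R * (v y ^+ (2 * k).+1 / m x y))%:E) <=
  (weak_const * A * be ^+ k * v x)%:E.
Proof.
move=> a0; set a := v x in a0 *; have ma := msec x.
(* These choices give the three terms below the same size A be^k a. *)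
pose r := (be / a ^+ 2)%R; pose s := (a / be)%R.
have r0 : (0 < r)%R by rewrite divr_gt0// exprn_gt0.
have s0 : (0 < s)%R by rewrite divr_gt0.
have pE : (2 * k.+1 = (2 * k).+2)%N by rewrite mulnS.
apply: (@le_trans _ _ (\int[mu]_y ((a ^+ (2 * k).+1)%:E * ((m x y < r)%R%:R / m x y)%:E +
   (s%:E * (v y ^+ (2 * k.+1))%:E +
    (s ^- (2 * k).+1)%:E * ((r <= m x y)%R%:R / m x y ^+ (2 * k.+1))%:E)))).
  apply: le_integral_ge0.
  - by measurability.
  - by measurability.
  - by move=> y; rewrite lee_fin mulr_ge0// divr_ge0// exprn_ge0.
  move=> y; rewrite -!EFinM -!EFinD lee_fin.
  have h1 : (0 <= s * v y ^+ (2 * k.+1))%R by rewrite mulr_ge0 ?exprn_ge0// ltW.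
  have sV : (0 <= s ^- (2 * k).+1)%R by rewrite invr_ge0 exprn_ge0// ltW.
  have aV : (0 <= a ^+ (2 * k).+1)%R by rewrite exprn_ge0// ltW.
  have [mr|mr] := ltP (m x y) r.
    rewrite mul0r mulr0 addr0 mul1r -[leLHS]addr0 lerD//.
    case: (boolP (v y <= a)%R) => [va|_]; last by rewrite mul0r divr_ge0.
    by rewrite mul1r ler_wpM2r ?invr_ge0// lerXn2r// ?nnegrE ?(ltW a0).
  rewrite mul0r mulr0 add0r mul1r.
  case: (boolP (v y <= a)%R) => [_|_]; last first.
    by rewrite mul0r addr_ge0// mulr_ge0// invr_ge0 exprn_ge0.
  rewrite mul1r; have my : (0 <= (m x y)^-1)%R by rewrite invr_ge0.
  have := mulXr_le_sum (2 * k).+1 (v0 y) s0 my.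
  by rewrite pE exprVn [(_^-1 / _)%R]mulrC.
rewrite ge0_integralD//=; last 4 first.
- by move=> y _; rewrite -EFinM lee_fin mulr_ge0 ?exprn_ge0 ?divr_ge0// ltW.
- by measurability.
- move=> y _; rewrite -!EFinM -EFinD lee_fin addr_ge0//
    mulr_ge0 ?invr_ge0 ?divr_ge0 ?exprn_ge0//; exact: ltW.
- by measurability.
rewrite ge0_integralD//=; last 4 first.
- by move=> y _; rewrite -!EFinM lee_fin mulr_ge0 ?exprn_ge0// ltW.
- by measurability.
- by move=> y _; rewrite -!EFinM lee_fin mulr_ge0 ?invr_ge0 ?divr_ge0 ?exprn_ge0//; exact: ltW.
- by measurability.
rewrite !ge0_integralZ ?lee_fin ?invr_ge0 ?exprn_ge0 ?(ltW a0) ?(ltW s0)//; last 6 first.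
- by measurability.
- by move=> y; rewrite lee_fin divr_ge0// exprn_ge0.
- by measurability.
- by move=> y; rewrite lee_fin exprn_ge0.
- by measurability.
- by move=> y; rewrite lee_fin divr_ge0.
rewrite vE; have nA := mA a0.
apply: (@le_trans _ _ ((a ^+ (2 * k).+1)%:E * (4 * A * r ^+ k)%:E +
  (s%:E * (A * be ^+ k.+1)%:E + (s ^- (2 * k).+1)%:E * (2 ^+ k.+2 * A / r ^+ k.+1)%:E))).
  apply: leeD; [|apply: leeD => //].
    rewrite lee_wpmul2l ?lee_fin ?exprn_ge0 ?(ltW a0)//.
    exact: integral_near.
  rewrite lee_wpmul2l ?lee_fin ?invr_ge0 ?exprn_ge0 ?(ltW s0)//.
  exact: integral_far.
rewrite -!EFinM -!EFinD lee_fin le_eqVlt; apply/orP; left; apply/eqP.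
have ak : (a ^+ k != 0)%R by rewrite expf_neq0// gt_eqF.
have bk : (be ^+ k != 0)%R by rewrite expf_neq0// gt_eqF.
have rk : (r ^+ k = be ^+ k / (a ^+ k) ^+ 2)%R.
  by rewrite /r expr_div_n -!exprM mulnC.
have sk : (s ^+ (2 * k).+1 = s * (a ^+ k / be ^+ k) ^+ 2)%R.
  by rewrite exprS mulnC exprM /s expr_div_n.
have aE : (a ^+ (2 * k).+1 = a * (a ^+ k) ^+ 2)%R by rewrite exprS mulnC exprM.
rewrite /weak_const aE sk !exprS rk /r /s.
set X := (a ^+ k)%R in ak *; set Y := (be ^+ k)%R in bk *; set W := (2 ^+ k)%R.
by field; rewrite ?bk ?ak ?gt_eqF.
Qed.

(** The Hardy-Littlewood-Sobolev inequality for the density v^(2k+1), in a form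
    that only involves the measure of the level sets of m: by symmetry it is enough
    to integrate over v (y) <= v (x).  The level sets are controlled only about
    points where v does not vanish, which are the only ones that contribute. *)
Lemma weak_kernel_bound :
  \int[mu]_x \int[mu]_y ((v x ^+ (2 * k).+1 * v y ^+ (2 * k).+1 / m x y)%:E) <=
  (2 * weak_const * A * be ^+ k * (A * be ^+ k.+1))%:E.
Proof.
have pE : (2 * k.+1 = (2 * k).+2)%N by rewrite mulnS.
pose g x y := ((v y <= v x)%R%:R * (v x ^+ (2 * k).+1 * v y ^+ (2 * k).+1 / m x y))%R.
have g0 x y : (0 <= g x y)%R by rewrite mulr_ge0// divr_ge0// mulr_ge0// exprn_ge0.
have mg : measurable_fun setT (fun z : T * T => (g z.1 z.2)%:E).
  by rewrite /g; measurability.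
have mg' : measurable_fun setT (fun z : T * T => (g z.2 z.1)%:E).
  apply: (measurableT_comp mg (_ : measurable_fun setT (fun z : T * T => (z.2, z.1)))).
  by measurability.
have gI : \int[mu]_x \int[mu]_y (g x y)%:E <=
    (weak_const * A * be ^+ k * (A * be ^+ k.+1))%:E.
  have w0 : (0 <= weak_const * A * be ^+ k)%R.
    by rewrite !mulr_ge0 ?addr_ge0 ?exprn_ge0// ltW.
  rewrite EFinM -vE -ge0_integralZ ?lee_fin//; last 2 first.
  - by measurability.
  - by move=> x; rewrite lee_fin exprn_ge0.
  apply: le_integral_ge0.
  - by apply: measurable_int1.
  - by measurability.
  - by move=> x; apply: integral_ge0 => y _; rewrite lee_fin.
  move=> x; have [x0|x0] := leP (v x) 0%R.
    have {}x0 : v x = 0%R by apply/le_anti/andP.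
    rewrite integral0_eq; first by rewrite x0 mule_ge0 ?lee_fin ?exprn_ge0.
    by move=> y _; rewrite /g x0 expr0n/= !mul0r mulr0.
  have mx := msec x.
  rewrite (_ : \int[mu]_y (g x y)%:E = (v x ^+ (2 * k).+1)%:E *
     \int[mu]_y (((v y <= v x)%R%:R * (v y ^+ (2 * k).+1 / m x y))%:E)); last first.
    rewrite -ge0_integralZ ?lee_fin ?exprn_ge0//.
    - by apply: eq_integral => y _; rewrite -EFinM; congr EFin; rewrite /g; ring.
    - by measurability.
    - by move=> y; rewrite lee_fin mulr_ge0// divr_ge0// exprn_ge0.
  apply: (@le_trans _ _ ((v x ^+ (2 * k).+1)%:E * (weak_const * A * be ^+ k * v x)%:E)).
    by rewrite lee_wpmul2l ?lee_fin ?exprn_ge0// integral_smaller.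
  rewrite -!EFinM lee_fin pE [leRHS]mulrC [(v x ^+ (2 * k).+2)%R]exprSr.
  by rewrite le_eqVlt; apply/orP; left; apply/eqP; ring.
apply: (@le_trans _ _ (\int[mu]_x \int[mu]_y ((g x y)%:E + (g y x)%:E))).
  apply: le_integral_ge0.
  - apply: measurable_int1; first by measurability.
    by move=> x y; rewrite lee_fin divr_ge0// mulr_ge0// exprn_ge0.
  - apply: measurable_int1; first exact: emeasurable_funD.
    by move=> x y; rewrite adde_ge0 ?lee_fin.
  - by move=> x; apply: integral_ge0 => y _; rewrite lee_fin divr_ge0// mulr_ge0// exprn_ge0.
  move=> x; have mx := msec x; apply: le_integral_ge0.
  - by measurability.
  - apply: (measurableT_comp (emeasurable_funD mg mg') (_ : measurable_fun setT (fun y => (x, y)))).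
    by measurability.
  - by move=> y; rewrite lee_fin divr_ge0// mulr_ge0// exprn_ge0.
  move=> y; rewrite -EFinD lee_fin /g (mC y x).
  rewrite [(v y ^+ _ * v x ^+ _)%R]mulrC -mulrDl ler_peMl//.
    by rewrite divr_ge0// mulr_ge0// exprn_ge0.
  by rewrite -natrD ler1n; case: (leP (v y) (v x)) => //= /ltW ->.
under eq_integral.
  move=> x _; rewrite ge0_integralD//=; last 4 first.
  - by move=> y _; rewrite lee_fin.
  - apply: (measurableT_comp mg (_ : measurable_fun setT (fun y => (x, y)))).
    by measurability.
  - by move=> y _; rewrite lee_fin.
  - apply: (measurableT_comp mg' (_ : measurable_fun setT (fun y => (x, y)))).
    by measurability.
  over.
rewrite ge0_integralD//=; last 4 first.
- by move=> x _; apply: integral_ge0 => y _; rewrite lee_fin.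
- by apply: measurable_int1.
- by move=> x _; apply: integral_ge0 => y _; rewrite lee_fin.
- apply: (@measurable_int1 _ _ _ _ _ mu (fun x y => (g y x)%:E)) => // x y.
  by rewrite lee_fin.
rewrite [X in _ + X]tonelli//; last by move=> x y; rewrite lee_fin.
rewrite (_ : 2 * _ * _ * _ * _ = weak_const * A * be ^+ k * (A * be ^+ k.+1) +
  weak_const * A * be ^+ k * (A * be ^+ k.+1))%R; last by ring.
by rewrite EFinD leeD.
Qed.

End weak_kernel.

(** * The dual transform composed with its adjoint *)

(** Hyperplane integrals are formulas from here on. *)
Ltac measurability ::=
  repeat first [ assumption | exact: measurable_cst | measurable_comp
    | lazymatch goal with
      | |- measurable_fun _ (fun x => hyper_int _ _ _) =>
        apply: measurable_hyper_int
      end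
    | measurability_step ].

Section tt_star.
Context {R : realType}.
Local Open Scope ereal_scope.
Notation leb := (@lebesgue_measure R).
Notation lam n := (lebesgue_tuple R n).
Notation RR := (measurableTypeR R).

Lemma lee_young (p q : \bar R) (l : R) : 0 <= p -> 0 <= q -> (0 < l)%R ->
  p * q <= l%:E * (p * p) + (l^-1)%:E * (q * q).
Proof.
case: p => [p||] //; case: q => [q||] // p0 q0 l0; rewrite ?lee_fin in p0 q0.
- have li : (0 < l^-1)%R by rewrite invr_gt0.
  rewrite -!EFinM -EFinD lee_fin.
  have : (0 <= l^-1 * (l * p - q) ^+ 2)%R by rewrite mulr_ge0 ?sqr_ge0// ltW.
  have -> : (l^-1 * (l * p - q) ^+ 2 = l * (p * p) + l^-1 * (q * q) - 2 * (p * q))%R.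
    by field; rewrite gt_eqF.
  have : (0 <= p * q)%R by rewrite mulr_ge0.
  lra.
- rewrite [X in _ + X](_ : _ = +oo); last by rewrite mulyy gt0_muley// lte_fin invr_gt0.
  by rewrite addey ?leey.
- rewrite [X in X + _](_ : _ = +oo); last by rewrite mulyy gt0_muley// lte_fin.
  by rewrite addye ?leey// -EFinM.
- by rewrite !mulyy !gt0_muley ?lte_fin ?invr_gt0// leey.
Qed.

Section dim.
Variable n : nat.
Notation V := (n.+2.-tuple R).

(** The dual transform, on homogeneous directions w, is the adjoint of integration
    over hyperplanes. *)
Lemma pairing_hyper_int (f : V -> \bar R) (phi : V -> R -> \bar R) :
  measurable_fun setT f -> (forall x, 0 <= f x) ->
  measurable_fun setT (fun z : V * RR => phi z.1 z.2) ->
  (forall w c, 0 <= phi w c) ->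
  \int[lam n.+2]_x (f x * \int[lam n.+2]_w phi w (dotp w x)) =
  \int[lam n.+2]_w \int[leb]_c (phi w c * hyper_int f w c).
Proof.
move=> mf f0 mphi phi0.
have mp d (T : measurableType d) (p : T -> V) (q : T -> R) :
    measurable_fun setT p -> measurable_fun setT q ->
    measurable_fun setT (fun z => phi (p z) (q z)).
  move=> m1 m2; apply: (measurableT_comp mphi (_ : measurable_fun setT (fun z => (p z, q z)))).
  exact: measurable_pairT.
transitivity (\int[lam n.+2]_x \int[lam n.+2]_w (f x * phi w (dotp w x))).
  apply: eq_integral => x _; rewrite ge0_integralZ//.
  by apply: mp; measurability.
rewrite tonelli; last 2 first.
- by measurability; apply: mp; measurability.
- by move=> *; exact: mule_ge0.
apply: (eq_integral_null (b := fun w => (tuncons w).1 != 0%R)).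
- by measurability.
- exact: head_null.
- apply: measurable_int1; last by move=> *; exact: mule_ge0.
  by measurability; apply: mp; measurability.
- apply: (@measurable_int1 _ _ _ _ _ leb (fun w c => phi w c * hyper_int f w c)).
    by measurability.
  by move=> *; rewrite mule_ge0// hyper_int_ge0.
- by move=> w; apply: integral_ge0 => *; exact: mule_ge0.
- by move=> w; apply: integral_ge0 => *; rewrite mule_ge0// hyper_int_ge0.
move=> w w0; apply: integral_hyper_int => //.
by apply: mp; measurability.
Qed.

(** Expanding the square gives the quadratic form of T T^*, where T is the dual
    transform of functions multiplied by the indicator Z.  Its kernel at x and
    x + y is the weight, according to Z, of the hyperplanes through both points. *)
Lemma quadratic_hyper_int (f : V -> \bar R) (Z : V -> R -> \bar R) :
  measurable_fun setT f -> (forall x, 0 <= f x) ->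
  measurable_fun setT (fun z : V * RR => Z z.1 z.2) ->
  (forall w c, 0 <= Z w c) ->
  \int[lam n.+2]_w \int[leb]_c (Z w c * hyper_int f w c * hyper_int f w c) =
  \int[lam n.+2]_x (f x * \int[lam n.+2]_w (Z w (dotp w x) * hyper_int f w (dotp w x)))
  /\ forall x, \int[lam n.+2]_w (Z w (dotp w x) * hyper_int f w (dotp w x)) =
    \int[lam n.+2]_y (f (addt x y) * hyper_int (fun w => Z w (dotp w x)) y 0).
Proof.
move=> mf f0 mZ Z0.
have mp d (T : measurableType d) (p : T -> V) (q : T -> R) :
    measurable_fun setT p -> measurable_fun setT q ->
    measurable_fun setT (fun z => Z (p z) (q z)).
  move=> m1 m2; apply: (measurableT_comp mZ (_ : measurable_fun setT (fun z => (p z, q z)))).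
  exact: measurable_pairT.
have N0 w c := hyper_int_ge0 w c f0.
split.
  rewrite (pairing_hyper_int (phi := fun w c => Z w c * hyper_int f w c))//.
  - by measurability.
  - by move=> w c; rewrite mule_ge0.
move=> x.
have mfx : measurable_fun setT (fun y => f (addt x y)) by measurability.
have mZx : measurable_fun setT (fun w => Z w (dotp w x)).
  by apply: mp; measurability.
apply: etrans (hyper_int_swap mZx (fun w => Z0 _ _) mfx (fun y => f0 _)).
apply: (eq_integral_null (b := fun w => (tuncons w).1 != 0%R)).
- by measurability.
- exact: head_null.
- by measurability.
- by measurability.
- by move=> w; rewrite mule_ge0.
- by move=> w; rewrite mule_ge0// hyper_int_ge0.
by move=> w w0; rewrite hyper_int_translate.
Qed.

Definition pair_dist (h : R) (x y : V) : R := strip_dist h x (addt (scalet (-1) x) y).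

Lemma pair_distC h x y : pair_dist h x y = pair_dist h y x.
Proof.
rewrite /pair_dist /strip_dist; congr Num.max.
  by congr Num.sqrt; rewrite !(dotpDl, dotpDr, dotpZl, dotpZr) (dotpC y x); ring.
congr (_ / _)%R.
by congr Num.sqrt; rewrite !(dotpDl, dotpDr, dotpZl, dotpZr) (dotpC y x); ring.
Qed.

Lemma pair_dist_ge0 h x y : (0 <= pair_dist h x y)%R.
Proof. exact: strip_dist_ge0. Qed.

Lemma addtKN (x y : V) : addt (scalet (-1) x) (addt x y) = y.
Proof. by apply: eq_from_tnth => i; rewrite !tnth_mktuple; ring. Qed.

Lemma kernel_const_gt0 : (0 < kernel_const n :> R)%R.
Proof.
rewrite /kernel_const ltr_pwDl ?ball_vol_gt0// mulr_ge0//.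
exact: sector_const_ge0.
Qed.

Variables (a b r : R).
Hypotheses (n2 : (2 <= n)%N) (ab : (a < b)%R) (r0 : (0 < r)%R).

Let Z (w : V) (c : R) : \bar R := ((in_strip a b w c)%:R)%:E.

Let Z0 w c : 0 <= Z w c. Proof. by rewrite lee_fin. Qed.

Let mZ : measurable_fun setT (fun z : V * RR => Z z.1 z.2).
Proof. by rewrite /Z; measurability. Qed.

(** The constant A in the bound A t^(n+2) for the measure of the points y with
    pair_dist (b - a) x y < t, uniform in |x| > r. *)
Definition strip_vol : R := (2 * ball_vol n.+1 * ((b - a) / r) ^+ n.+1)%R.

Lemma strip_vol_gt0 : (0 < strip_vol)%R.
Proof.
by rewrite !mulr_gt0 ?ball_vol_gt0// exprn_gt0// divr_gt0// subr_gt0.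
Qed.

Section density.
Variable v : V -> R.
Hypotheses (mv : measurable_fun setT v) (v0 : forall x, (0 <= v x)%R).
Hypothesis vr : forall x, (0 < v x)%R -> (r < enorm x)%R.
Variable be : R.
Hypotheses (be0 : (0 < be)%R)
  (vE : \int[lam n.+2]_x (v x ^+ (2 * n.+2))%:E = (strip_vol * be ^+ n.+2)%:E).

Let f (x : V) : \bar R := (v x ^+ (2 * n.+1).+1)%:E.

(** The kernel is bounded by the reciprocal of pair_dist, whose level sets are
    small about points outside the ball of radius r. *)
Lemma quadratic_bound :
  \int[lam n.+2]_w \int[leb]_c (Z w c * hyper_int f w c * hyper_int f w c) <=
  (2 * kernel_const n * weak_const n.+1 * strip_vol * be ^+ n.+1 *
   (strip_vol * be ^+ n.+2))%:E.
Proof.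
have f0 x : 0 <= f x by rewrite lee_fin exprn_ge0.
have mf : measurable_fun setT f by rewrite /f; measurability.
have [-> E2] := quadratic_hyper_int mf f0 mZ Z0.
have N0 w c := hyper_int_ge0 w c f0.
have h0 : (0 < b - a)%R by rewrite subr_gt0.
have kc := kernel_const_gt0.
have mpd : measurable_fun setT (fun z : V * V => pair_dist (b - a) z.1 z.2).
  by rewrite /pair_dist; measurability.
have px0 x y : 0 <= (v x ^+ (2 * n.+1).+1 * v y ^+ (2 * n.+1).+1 /
    pair_dist (b - a) x y)%:E.
  rewrite lee_fin; apply: divr_ge0; last exact: pair_dist_ge0.
  by apply: mulr_ge0; exact: exprn_ge0.
apply: (@le_trans _ _ (\int[lam n.+2]_x ((kernel_const n)%:E * \int[lam n.+2]_y
    (v x ^+ (2 * n.+1).+1 * v y ^+ (2 * n.+1).+1 / pair_dist (b - a) x y)%:E))).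
  apply: le_integral_ge0.
  - apply: emeasurable_funM => //; apply: measurable_int1 => [|x w].
      by rewrite /Z; measurability.
    exact: mule_ge0.
  - apply: emeasurable_funM => //; apply: measurable_int1 => [|x y].
      by measurability.
    exact: px0.
  - by move=> x; rewrite mule_ge0//; apply: integral_ge0 => w _; rewrite mule_ge0.
  move=> x; rewrite E2.
  have mZx : measurable_fun setT (fun w => Z w (dotp w x)).
    by rewrite /Z; measurability.
  have mpx : measurable_fun setT (pair_dist (b - a) x).
    by rewrite /pair_dist; measurability.
  have mpx' : measurable_fun setT
      (fun y => (v x ^+ (2 * n.+1).+1 * v y ^+ (2 * n.+1).+1 / pair_dist (b - a) x y)%:E).
    by measurability.
  rewrite -[X in _ <= _ * X](integral_addt x)// -!ge0_integralZ//; last 4 first.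
  - by measurability.
  - by rewrite lee_fin ltW.
  - by measurability.
  - by move=> y; rewrite mule_ge0// hyper_int_ge0.
  apply: (le_integral_null (b := fun y => (tuncons y).1 != 0%R)).
  - by measurability.
  - exact: head_null.
  - by measurability.
  - by measurability.
  - move=> y; apply: mule_ge0 => //; apply: mule_ge0 => //.
    by apply: hyper_int_ge0 => w; exact: Z0.
  - by move=> y; rewrite mule_ge0// lee_fin ltW.
  move=> y y0; have := @hyper_int_strip R n a b x y n2 ab y0.
  rewrite /pair_dist addtKN.
  rewrite (_ : hyper_int _ y 0 = hyper_int (fun w => Z w (dotp w x)) y 0); last first.
    by congr (hyper_int _ y 0); apply/funext => w; rewrite /Z dotpC.
  move=> H; apply: (@le_trans _ _
    (f x * (f (addt x y) * (kernel_const n / strip_dist (b - a) x y)%:E))).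
    by rewrite !lee_wpmul2l.
  rewrite /f -!EFinM lee_fin le_eqVlt; apply/orP; left; apply/eqP.
  by ring.
rewrite ge0_integralZ; last 3 first.
- apply: measurable_int1 => [|x y]; first by measurability.
  exact: px0.
- move=> x; apply: integral_ge0 => y _.
  exact: px0.
- by rewrite lee_fin ltW.
have := @weak_kernel_bound R _ _ (lam n.+2) n.+1 strip_vol isT strip_vol_gt0
  (pair_dist (b - a)) mpd (fun x y => strip_dist_ge0 _ _ _) (pair_distC (b - a)) v mv v0.
move=> /(_ _ be be0 vE) H.
rewrite (_ : 2 * _ * _ * _ * _ * _ = kernel_const n * (2 * weak_const n.+1 * strip_vol *
  be ^+ n.+1 * (strip_vol * be ^+ n.+2)))%R; last by ring.
rewrite EFinM lee_wpmul2l ?lee_fin ?(ltW kc)//; apply: H.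
move=> x vx t t0.
rewrite -(integral_addt x)//; last first.
  by rewrite /pair_dist; measurability.
under eq_integral do rewrite /pair_dist addtKN.
apply: measure_strip_ball => //; exact: vr.
Qed.

End density.

Definition unit_dir (w : V) : V := scalet (enorm w)^-1 w.

Definition punctured (w : V) : bool := ((0 < enorm w) && (enorm w <= 1))%R.

(** Up to the factor 1 / (n + 2), the integral over the product of the line and
    the unit sphere, each direction being spread over a radius of the ball. *)
Definition polar_int (g : R * V -> \bar R) : \bar R :=
  \int[lam n.+2]_w (((punctured w)%:R)%:E * \int[leb]_s g (s, unit_dir w)).

(** The dual Radon transform of g, with the same convention for the sphere. *)
Definition backproj (g : R * V -> \bar R) (x : V) : \bar R :=
  \int[lam n.+2]_w (((punctured w)%:R)%:E * g (dotp x (unit_dir w), unit_dir w)).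

Lemma measurable_unit_dir : measurable_fun setT unit_dir.
Proof. by rewrite /unit_dir; measurability. Qed.

Lemma measurable_punctured : measurable_fun setT punctured.
Proof. by rewrite /punctured; measurability. Qed.

Let mud := measurable_unit_dir.
Let mpc := measurable_punctured.

(** The dilation by |w| costs the factor |w| <= 1. *)
Lemma polar_int_dilation (g : R * V -> \bar R) :
  measurable_fun setT (g : RR * V -> \bar R) -> (forall z, 0 <= g z) ->
  \int[lam n.+2]_w \int[leb]_c
     (((punctured w)%:R)%:E * g ((c / enorm w)%R, unit_dir w)) <= polar_int g.
Proof.
move=> mg g0; apply: le_integral_ge0.
- apply: measurable_int1 => [|w c]; last by rewrite mule_ge0.
  by measurability.
- apply: emeasurable_funM; first by measurability.
  by apply: (@measurable_int1 _ _ _ _ _ leb (fun w s => g (s, unit_dir w))) => //; measurability.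
- by move=> w; apply: integral_ge0 => c _; rewrite mule_ge0.
move=> w; case: (boolP (punctured w)) => [/andP[w0 w1]|_]; last first.
  by rewrite mul0e integral0_eq// => c _; rewrite mul0e.
have mgw : measurable_fun setT (fun s : RR => g (s, unit_dir w)) by measurability.
have wn : ((enorm w)^-1 != 0)%R by rewrite invr_eq0 gt_eqF.
rewrite mul1e.
apply: (@le_trans _ _ (\int[leb]_c g (((enorm w)^-1 * c + 0)%R, unit_dir w))).
  rewrite le_eqVlt; apply/orP; left; apply/eqP; apply: eq_integral => c _.
  by rewrite mul1e addr0 mulrC.
rewrite (ge0_integral_affine 0 wn (f := fun s => g (s, unit_dir w)))//.
rewrite gtr0_norm ?invr_gt0// invrK gee_pMl//.
exact: integral_ge0.
Qed.

Lemma integral_integralD (p q : V -> R -> \bar R) :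
  measurable_fun setT (fun z : V * RR => p z.1 z.2) ->
  measurable_fun setT (fun z : V * RR => q z.1 z.2) ->
  (forall w c, 0 <= p w c) -> (forall w c, 0 <= q w c) ->
  \int[lam n.+2]_w \int[leb]_c (p w c + q w c) =
  \int[lam n.+2]_w \int[leb]_c p w c + \int[lam n.+2]_w \int[leb]_c q w c.
Proof.
move=> mp mq p0 q0.
have sec (h : V -> R -> \bar R) w : measurable_fun setT (fun z : V * RR => h z.1 z.2) ->
    measurable_fun setT (h w).
  move=> mh; apply: (measurableT_comp mh (_ : measurable_fun setT (fun c : RR => (w, c)))).
  by measurability.
rewrite -ge0_integralD//=; last 4 first.
- by move=> w _; apply: integral_ge0.
- exact: measurable_int1.
- by move=> w _; apply: integral_ge0.
- exact: measurable_int1.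
by apply: eq_integral => w _; rewrite ge0_integralD//; exact: sec.
Qed.

Lemma integral_integralZ (k : \bar R) (p : V -> R -> \bar R) :
  measurable_fun setT (fun z : V * RR => p z.1 z.2) ->
  (forall w c, 0 <= p w c) -> 0 <= k ->
  \int[lam n.+2]_w \int[leb]_c (k * p w c) =
  k * \int[lam n.+2]_w \int[leb]_c p w c.
Proof.
move=> mp p0 k0.
rewrite -ge0_integralZ//; last 2 first.
- exact: measurable_int1.
- by move=> w; apply: integral_ge0.
apply: eq_integral => w _; rewrite ge0_integralZ//.
apply: (measurableT_comp mp (_ : measurable_fun setT (fun c : RR => (w, c)))).
by measurability.
Qed.

Definition backproj_const : R := (8 * kernel_const n * weak_const n.+1)%R.

Section main_estimate.
Variables (g : R * V -> \bar R) (nul : R * V -> bool).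
Hypotheses (mg : measurable_fun setT (g : RR * V -> \bar R))
  (g0 : forall z, 0 <= g z)
  (mnul : measurable_fun setT (nul : RR * V -> bool))
  (nul0 : polar_int (fun z => ((nul z)%:R)%:E) = 0)
  (supp : forall z, ~~ nul z -> ~~ ((a < z.1) && (z.1 <= b))%R -> g z = 0).
Variable ga : R.
Hypothesis gE : polar_int (fun z => g z * g z) <= ga%:E.
Variable v : V -> R.
Hypotheses (mv : measurable_fun setT v) (v0 : forall x, (0 <= v x)%R).
Hypothesis vr : forall x, (0 < v x)%R -> (r < enorm x)%R.
Hypothesis vg : forall x, (v x)%:E <= backproj g x.

Let phi (w : V) (c : R) : \bar R :=
  ((punctured w)%:R)%:E * g ((c / enorm w)%R, unit_dir w).

(** Pairing the dual transform with v^(2n+3) and using Young's inequality leaves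
    the square integral of g and the quadratic form of T T^*.  The exceptional set
    nul enters through an additional term, infinite on it, of integral zero. *)
Lemma pairing_bound (be l : R) : (0 < be)%R -> (0 < l)%R ->
  \int[lam n.+2]_x (v x ^+ (2 * n.+2))%:E = (strip_vol * be ^+ n.+2)%:E ->
  (strip_vol * be ^+ n.+2)%:E <= l%:E * ga%:E + (l^-1)%:E *
  (2 * kernel_const n * weak_const n.+1 * strip_vol * be ^+ n.+1 *
   (strip_vol * be ^+ n.+2))%:E.
Proof.
move=> be0 l0 vE.
pose f (x : V) : \bar R := (v x ^+ (2 * n.+1).+1)%:E.
have f0 x : 0 <= f x by rewrite lee_fin exprn_ge0.
have mf : measurable_fun setT f by rewrite /f; measurability.
have N0 w c := hyper_int_ge0 w c f0.
have phi0 w c : 0 <= phi w c by rewrite mule_ge0.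
have mphi : measurable_fun setT (fun z : V * RR => phi z.1 z.2).
  by rewrite /phi; measurability.
have li : (0 <= l^-1)%R by rewrite invr_ge0 ltW.
pose nl (w : V) (c : R) : \bar R :=
  ((punctured w)%:R)%:E * ((nul ((c / enorm w)%R, unit_dir w))%:R)%:E.
have nl0 w c : 0 <= nl w c by rewrite mule_ge0.
have mnl : measurable_fun setT (fun z : V * RR => nl z.1 z.2).
  by rewrite /nl; measurability.
have p1 : measurable_fun setT (fun z : V * RR => phi z.1 z.2 * phi z.1 z.2).
  exact: emeasurable_funM.
have p2 : measurable_fun setT (fun z : V * RR =>
    Z z.1 z.2 * hyper_int f z.1 z.2 * hyper_int f z.1 z.2).
  by measurability.
have t1 w c : 0 <= l%:E * (phi w c * phi w c).
  by apply: mule_ge0; [rewrite lee_fin ltW|exact: mule_ge0].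
have t2 w c : 0 <= (l^-1)%:E * (Z w c * hyper_int f w c * hyper_int f w c).
  by apply: mule_ge0; [rewrite lee_fin|rewrite mule_ge0// mule_ge0].
rewrite -vE.
apply: (@le_trans _ _ (\int[lam n.+2]_x (f x * \int[lam n.+2]_w phi w (dotp w x)))).
  apply: le_integral_ge0.
  - by measurability.
  - apply: emeasurable_funM => //;
      apply: (@measurable_int1 _ _ _ _ _ (lam n.+2) (fun x w => phi w (dotp w x))) => //.
    by rewrite /phi; measurability.
  - by move=> x; rewrite lee_fin exprn_ge0.
  move=> x; rewrite (_ : 2 * n.+2 = (2 * n.+1).+2)%N; last by rewrite mulnS.
  rewrite exprSr EFinM; apply: lee_wpmul2l; first exact: f0.
  apply: (le_trans (vg x)).
  rewrite le_eqVlt; apply/orP; left; apply/eqP; apply: eq_integral => w _.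
  by rewrite /phi /unit_dir dotpZr mulrC dotpC.
rewrite pairing_hyper_int//.
apply: (@le_trans _ _ (\int[lam n.+2]_w \int[leb]_c
   (l%:E * (phi w c * phi w c) + ((l^-1)%:E * (Z w c * hyper_int f w c * hyper_int f w c) +
    +oo * nl w c)))).
  have q0 w c : 0 <= l%:E * (phi w c * phi w c) +
      ((l^-1)%:E * (Z w c * hyper_int f w c * hyper_int f w c) + +oo * nl w c).
    by rewrite adde_ge0// adde_ge0// mule_ge0.
  have mQ : measurable_fun setT (fun z : V * RR => l%:E * (phi z.1 z.2 * phi z.1 z.2) +
      ((l^-1)%:E * (Z z.1 z.2 * hyper_int f z.1 z.2 * hyper_int f z.1 z.2) + +oo * nl z.1 z.2)).
    apply: emeasurable_funD; first by measurability.
    by apply: emeasurable_funD; measurability.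
  have mP : measurable_fun setT (fun z : V * RR => phi z.1 z.2 * hyper_int f z.1 z.2).
    by measurability.
  have sec (h : V -> R -> \bar R) w : measurable_fun setT (fun z : V * RR => h z.1 z.2) ->
      measurable_fun setT (h w).
    move=> mh; apply: (measurableT_comp mh (_ : measurable_fun setT (fun c : RR => (w, c)))).
    by measurability.
  apply: le_integral_ge0.
  - by apply: measurable_int1 => // w c; rewrite mule_ge0.
  - exact: measurable_int1.
  - by move=> w; apply: integral_ge0 => c _; rewrite mule_ge0.
  move=> w; apply: le_integral_ge0.
  - exact: (sec (fun w c => phi w c * hyper_int f w c) w mP).
  - exact: (sec (fun w c => l%:E * (phi w c * phi w c) +
      ((l^-1)%:E * (Z w c * hyper_int f w c * hyper_int f w c) + +oo * nl w c)) w mQ).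
  - by move=> c; rewrite mule_ge0.
  move=> c; case: (boolP (punctured w)) => pw; last first.
    by rewrite {1}/phi (negbTE pw) !mul0e.
  case: (boolP (nul ((c / enorm w)%R, unit_dir w))) => nw.
    rewrite [X in _ + (_ + X)](_ : _ = +oo); last first.
      by rewrite /nl pw nw mul1e mule1.
    have ay (x : \bar R) : 0 <= x -> x + +oo = +oo by case: x.
    by rewrite !ay ?leey.
  rewrite [X in _ + (_ + X)](_ : _ = 0); last first.
    by rewrite /nl (negbTE nw) mule0 mule0.
  rewrite adde0; case/andP: (pw) => w0 w1.
  case: (boolP ((a < c / enorm w) && (c / enorm w <= b))%R) => ac; last first.
    have := supp nw ac; rewrite /phi => ->; by rewrite mule0 !mul0e mule0 add0e.
  rewrite /Z /in_strip w0 w1/= -ltr_pdivlMr// -ler_pdivrMr// ac mul1e.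
  exact: lee_young.
rewrite integral_integralD; last 4 first.
- by measurability.
- by apply: emeasurable_funD; measurability.
- by [].
- by move=> w c; rewrite adde_ge0// mule_ge0.
rewrite integral_integralD; last 4 first.
- by measurability.
- by measurability.
- by [].
- by move=> w c; rewrite mule_ge0.
rewrite (integral_integralZ (k := l%:E) (p := fun w c => phi w c * phi w c)) ?lee_fin ?(ltW l0)//;
  last by move=> w c; rewrite mule_ge0.
rewrite (integral_integralZ (k := (l^-1)%:E)
    (p := fun w c => Z w c * hyper_int f w c * hyper_int f w c)) ?lee_fin//;
  last by move=> w c; rewrite mule_ge0// mule_ge0.
rewrite (integral_integralZ (k := +oo) (p := nl))//.
have -> : \int[lam n.+2]_w \int[leb]_c nl w c = 0.
  apply/le_anti/andP; split; last by apply: integral_ge0 => w _; apply: integral_ge0.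
  rewrite -nul0; apply: (polar_int_dilation (g := fun z => ((nul z)%:R)%:E)) => //.
  by measurability.
rewrite mule0 adde0; apply: leeD; last first.
  by rewrite lee_wpmul2l ?lee_fin//; exact: quadratic_bound.
rewrite lee_wpmul2l ?lee_fin ?(ltW l0)//; apply: le_trans gE.
apply: le_trans (polar_int_dilation (g := fun z => g z * g z) _ _); last 2 first.
- by measurability.
- by move=> z; rewrite mule_ge0.
rewrite le_eqVlt; apply/orP; left; apply/eqP.
apply: eq_integral => w _; apply: eq_integral => c _.
by rewrite /phi; case: (punctured w); rewrite ?mul1e ?mul0e ?mule0.
Qed.

(** With be such that the integral of v^(2n+4) is strip_vol be^(n+2), the quadratic
    term of the previous bound is a multiple of be^(n+1) times that integral. *)
Lemma backproj_bound (e : R) :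
  \int[lam n.+2]_x (v x ^+ (2 * n.+2))%:E = e%:E ->
  (e <= strip_vol * (backproj_const * ga) ^+ n.+2)%R.
Proof.
move=> vE; have sv := strip_vol_gt0; have kc := kernel_const_gt0.
have wc : (0 < weak_const n.+1 :> R)%R by rewrite /weak_const addr_gt0// exprn_gt0.
have bc : (0 < backproj_const)%R by rewrite !mulr_gt0.
have ga0 : (0 <= ga)%R.
  rewrite -lee_fin; apply: le_trans gE; apply: integral_ge0 => w _.
  by rewrite mule_ge0//; apply: integral_ge0 => s _; rewrite mule_ge0.
have [e0|e0] := leP e 0%R.
  apply: (le_trans e0); rewrite mulr_ge0 ?(ltW sv)// exprn_ge0// mulr_ge0//.
  exact: ltW.
pose be := ((e / strip_vol) `^ (n.+2%:R^-1))%R.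
have be0 : (0 < be)%R by apply: powR_gt0; exact: divr_gt0.
have beE : (strip_vol * be ^+ n.+2 = e)%R.
  rewrite /be -powR_mulrn ?powR_ge0// -powRrM mulVf ?pnatr_eq0// powRr1.
    by rewrite mulrC divfK// gt_eqF.
  by rewrite divr_ge0// ltW.
rewrite -beE in vE *.
pose q := (strip_vol * be ^+ n.+1)%R.
have q0 : (0 < q)%R by rewrite mulr_gt0// exprn_gt0.
(* This value makes the quadratic term half of the integral of v^(2n+4). *)
pose l := (4 * kernel_const n * weak_const n.+1 * q)%R.
have l0 : (0 < l)%R.
  by apply: mulr_gt0 => //; apply: mulr_gt0 => //; apply: mulr_gt0.
have := pairing_bound be0 l0 vE; rewrite -!EFinM -EFinD lee_fin => h.
rewrite ler_wpM2l ?(ltW sv)//; apply: lerXn2r; rewrite ?nnegrE ?(ltW be0)//.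
  by rewrite mulr_ge0// ltW.
have eq1 : (strip_vol * be ^+ n.+2 = q * be)%R by rewrite /q exprSr mulrA.
have eq2 : (l^-1 * (2 * kernel_const n * weak_const n.+1 * strip_vol * be ^+ n.+1 *
   (strip_vol * be ^+ n.+2)) = q * be / 2)%R.
  by rewrite eq1 /l /q; field; rewrite ?gt_eqF ?exprn_gt0.
have eq3 : (l * ga = q * (backproj_const * ga / 2))%R.
  by rewrite /l /backproj_const; field.
move: h; rewrite eq2 eq3 eq1 => h.
rewrite -(ler_pM2l q0).
move: h; rewrite !mulrA; set X := (q * be)%R; set Y := (q * backproj_const * ga)%R.
lra.
Qed.

End main_estimate.

End dim.
End tt_star.

(** * Removing the truncation *)

Section truncation.
Context {R : realType}.
Local Open Scope ereal_scope.
Notation lam n := (lebesgue_tuple R n).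
Notation RR := (measurableTypeR R).
Variable n : nat.
Notation V := (n.+2.-tuple R).
Variables (a b r : R).
Hypotheses (n2 : (2 <= n)%N) (ab : (a < b)%R) (r0 : (0 < r)%R).
Variables (g : R * V -> \bar R) (nul : R * V -> bool).
Hypotheses (mg : measurable_fun setT (g : RR * V -> \bar R))
  (g0 : forall z, 0 <= g z)
  (mnul : measurable_fun setT (nul : RR * V -> bool))
  (nul0 : polar_int (fun z => ((nul z)%:R)%:E) = 0)
  (supp : forall z, ~~ nul z -> ~~ ((a < z.1) && (z.1 <= b))%R -> g z = 0).
Variable ga : R.
Hypothesis gE : polar_int (fun z => g z * g z) <= ga%:E.

Let mud := @measurable_unit_dir R n.
Let mpc := @measurable_punctured R n.

Lemma backproj_ge0 x : 0 <= backproj g x.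
Proof. by apply: integral_ge0 => w _; rewrite mule_ge0. Qed.

Lemma measurable_backproj : measurable_fun setT (backproj g).
Proof.
apply: (@measurable_int1 _ _ _ _ _ (lam n.+2) (fun x w =>
  ((punctured w)%:R)%:E * g (dotp x (unit_dir w), unit_dir w))) => [|x w].
  by measurability.
by rewrite mule_ge0.
Qed.

(** The bound on v absorbs a multiple of the integral of v^(2n+4), which must
    therefore be finite: hence truncations of the dual transform in size and
    support, to be removed by monotone convergence. *)
Let v (N : nat) (x : V) : R :=
  (((r < enorm x) && (enorm x <= N.+1%:R))%:R *
   fine (mine (backproj g x) N.+1%:R%:E))%R.

Let mf N x : mine (backproj g x) N.+1%:R%:E \is a fin_num.
Proof.
rewrite ge0_fin_numE; first by rewrite gt_min ltry orbT.
by rewrite le_min backproj_ge0 lee_fin ler0n.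
Qed.

Let m0 N x : (0 <= fine (mine (backproj g x) N.+1%:R%:E))%R.
Proof. by rewrite fine_ge0// le_min backproj_ge0 lee_fin ler0n. Qed.

Let v0 N x : (0 <= v N x)%R.
Proof. by rewrite mulr_ge0. Qed.

Let vB N x : (v N x)%:E <= backproj g x.
Proof.
rewrite /v; case: andP => _; last by rewrite mul0r backproj_ge0.
by rewrite mul1r fineK// ge_min lexx.
Qed.

Let vr N x : (0 < v N x)%R -> (r < enorm x)%R.
Proof. by rewrite /v; case: (ltP r (enorm x)) => //=; rewrite mul0r ltxx. Qed.

Let mv N : measurable_fun setT (v N).
Proof.
have mB := measurable_backproj; rewrite /v; apply: measurable_funM.
  by measurability.
apply: measurableT_comp; first exact: fine_measurable.
exact: measurable_mine.
Qed.

Let v_nd N M x : (N <= M)%N -> (v N x <= v M x)%R.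
Proof.
move=> NM; rewrite /v.
have NM' : (N.+1%:R <= M.+1%:R :> R)%R by rewrite ler_nat ltnS.
case: (ltP r (enorm x)) => rx /=; last by rewrite !mul0r.
case: (leP (enorm x) N.+1%:R) => xN; last first.
  by rewrite mul0r mulr_ge0.
rewrite (le_trans xN NM') !mul1r fine_le//.
rewrite le_min ge_min lexx/= ge_min; apply/orP; right.
by rewrite lee_fin.
Qed.

Let v_lty N : \int[lam n.+2]_x (v N x ^+ (2 * n.+2))%:E \is a fin_num.
Proof.
have mvN := mv N; rewrite ge0_fin_numE; last first.
  by apply: integral_ge0 => x _; rewrite lee_fin exprn_ge0.
apply: (@le_lt_trans _ _ (\int[lam n.+2]_x
   ((N.+1%:R ^+ (2 * n.+2))%:E * ((inball N.+1%:R x)%:R)%:E))).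
  apply: le_integral_ge0.
  - by measurability.
  - by measurability.
  - by move=> x; rewrite lee_fin exprn_ge0.
  move=> x; rewrite -EFinM lee_fin /v /inball.
  case: (ltP r (enorm x)) => rx /=; last by rewrite mul0r expr0n/= mulr_ge0// exprn_ge0.
  case: (leP (enorm x) N.+1%:R) => xN; last by rewrite mul0r expr0n/= mulr_ge0// exprn_ge0.
  rewrite mul1r mulr1 lerXn2r// ?nnegrE//.
  by rewrite -lee_fin fineK// ge_min lexx orbT.
rewrite ge0_integralZ//; last by measurability.
have mi : measurable_fun setT (fun x : V => inball N.+1%:R x) by measurability.
have -> : \int[lam n.+2]_x ((inball N.+1%:R x)%:R)%:E =
    (N.+1%:R ^+ n.+2 * ball_vol n.+2)%:E.
  by apply: etrans (integral_bool _ mi) _; exact: measure_ball.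
by rewrite -EFinM ltry.
Qed.

(** The dual transform may be infinite, in which case the last clause forces W to
    be infinite as well; W stands for its power of exponent 2n+4. *)
Lemma backproj_Lp : exists W : V -> \bar R,
  [/\ measurable_fun setT W, forall x, 0 <= W x,
    \int[lam n.+2]_x W x <=
      (strip_vol n a b r * (backproj_const n * ga) ^+ n.+2)%:E &
    forall x (y : R), (r < enorm x)%R -> (0 <= y)%R -> y%:E <= backproj g x ->
      (y ^+ (2 * n.+2))%:E <= W x].
Proof.
pose F N x := (v N x ^+ (2 * n.+2))%:E.
have F0 N x : 0 <= F N x by rewrite lee_fin exprn_ge0.
have mF N : measurable_fun setT (F N) by have mvN := mv N; rewrite /F; measurability.
have F_nd x : {homo F^~ x : N M / (N <= M)%N >-> N <= M}.
  by move=> N M NM; rewrite lee_fin lerXn2r// ?nnegrE// v_nd.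
have FW N x : F N x <= limn (F^~ x).
  have -> := cvg_lim _ (ereal_nondecreasing_cvgn (F_nd x)); last by [].
  by apply: ereal_sup_ubound; exists N.
exists (fun x => limn (F^~ x)); split.
- apply: (emeasurable_fun_cvg F) => // x _.
  exact: ereal_nondecreasing_is_cvgn.
- by move=> x; apply: le_trans (FW 0%N x).
- rewrite monotone_convergence//.
  apply: lime_le.
    apply: ereal_nondecreasing_is_cvgn => N M NM.
    by apply: le_integral_ge0 => // x; exact: F_nd.
  apply: nearW => N; rewrite -(fineK (v_lty N)) lee_fin.
  apply: (backproj_bound n2 ab r0 mg g0 mnul nul0 supp gE (mv N) (v0 N) (@vr N) (vB N)).
  exact/esym/fineK/v_lty.
- move=> x y rx y0 yB.
  have [N xN yN] : exists2 N, (enorm x <= N.+1%:R)%R & (y <= N.+1%:R)%R.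
    exists (maxn (Num.bound (enorm x)) (Num.bound y)).
      apply: le_trans (ltW (archi_boundP (enorm_ge0 x))) _.
      by rewrite ler_nat leqW// leq_maxl.
    apply: le_trans (ltW (archi_boundP y0)) _.
    by rewrite ler_nat leqW// leq_maxr.
  apply: le_trans (FW N x); rewrite lee_fin lerXn2r// ?nnegrE//.
  by rewrite /v rx xN mul1r -lee_fin fineK// le_min yB lee_fin.
Qed.

End truncation.

(** * The surface measure in polar coordinates *)

Section surface.
Context {R : realType}.
Local Open Scope ereal_scope.
Notation leb := (@lebesgue_measure R).
Notation lam n := (lebesgue_tuple R n).
Notation RR := (measurableTypeR R).
Variable n : nat.
Notation V := (n.+2.-tuple R).
Notation sigma := (surface_measure R n.+2).

Let mud := @measurable_unit_dir R n.
Let mpc := @measurable_punctured R n.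

(** Directions outside the punctured ball are sent to the origin, off the sphere. *)
Let psi (w : V) : V := if punctured w then unit_dir w else zerot n.+2.

Let mpsi : measurable_fun setT psi.
Proof. by apply: measurable_fun_ifT. Qed.

Let psi_sphere w : sphere R n.+2 (psi w) <-> punctured w.
Proof.
rewrite /psi; case: (boolP (punctured w)) => [/andP[w0 w1]|_]; split => //.
  move=> _; rewrite /sphere/= /unit_dir enorm_scalet gtr0_norm ?invr_gt0//.
  by rewrite mulVf// gt_eqF.
by rewrite /sphere /= /enorm dotp0l sqrtr0 => /eqP; rewrite eq_sym oner_eq0.
Qed.

Lemma integral_surface (F : V -> \bar R) :
  measurable_fun setT F -> (forall w, 0 <= F w) ->
  \int[sigma]_(w in sphere R n.+2) F w =
  n.+2%:R%:E * \int[lam n.+2]_w (((punctured w)%:R)%:E * F (unit_dir w)).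
Proof.
move=> mF F0; have mS := @measurable_sphere R n.+2.
have [k hk] : exists k : {nonneg R}, (k%:num = n.+2%:R)%R.
  have d0 : (0 <= n.+2%:R :> R)%R by [].
  by exists (NngNum d0).
pose nu := measure_function_pushforward__canonical__measure_function_Measure
  (lam n.+2) mpsi.
pose mu := mscale k nu.
rewrite (@eq_measure_integral _ _ _ _ mu); last first.
  move=> A mA AS; rewrite /mu /mscale /= /nu /= /pushforward /surface_measure -hk.
  congr (_ * lam n.+2 _); apply/seteqP; split=> x /=.
    by move=> [pw Ax]; rewrite /psi /punctured pw.
  move=> Ax; have pw := (psi_sphere x).1 (AS _ Ax).
  by split => //; move: Ax; rewrite /psi pw.
have mFS : measurable_fun (sphere R n.+2) F by exact: measurable_funTS.
rewrite (ge0_integral_mscale nu mS _ mFS (fun x _ => F0 x)).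
have F0' : {in sphere R n.+2, forall y, 0 <= F y} by move=> y _.
rewrite [X in X%:E * _]hk.
have E (c x y : \bar R) : x = y -> c * x = c * y by move=> ->.
apply: (E).
apply: etrans (ge0_integral_pushforward mpsi (lam n.+2) mS mFS F0') _.
rewrite integral_mkcond; apply: eq_integral => w _; rewrite patchE.
case: (boolP (punctured w)) => pw.
  rewrite mem_set; last exact/psi_sphere.
  by rewrite mul1e /= /psi pw.
rewrite memNset ?mul0e//= => /psi_sphere pw'.
by rewrite pw' in pw.
Qed.

Lemma integral_cylinder (h : RR * V -> \bar R) :
  measurable_fun setT h -> (forall z, 0 <= h z) ->
  \int[cylinder_measure]_z h z = n.+2%:R%:E * polar_int h.
Proof.
move=> mh h0; rewrite /cylinder_measure (fubini_tonelli2 h)//.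
have mS := @measurable_sphere R n.+2.
pose H (w : V) := \int[leb]_s h (s, w).
have mH : measurable_fun setT H.
  apply: (@measurable_int1 _ _ _ _ _ leb (fun w s => h (s, w))) => //.
  by measurability.
have H0 w : 0 <= H w by exact: integral_ge0.
rewrite /fubini_G /polar_int -(integral_surface (F := H))//.
have mSC : measurable (~` sphere R n.+2) by exact: measurableC.
have S0 : sigma (~` sphere R n.+2) = 0 by exact: surface_measure_sphereC.
rewrite (ge0_negligible_integral mSC measurableT mH (fun x _ => H0 x) S0).
by rewrite setDE setTI setCK.
Qed.

End surface.

(** * Square-integrable functions on the cylinder *)

Section square_integrable.
Context {R : realType}.
Local Open Scope ereal_scope.
Notation leb := (@lebesgue_measure R).
Notation lam n := (lebesgue_tuple R n).
Notation RR := (measurableTypeR R).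
Variable n : nat.
Notation V := (n.+2.-tuple R).
Notation sigma := (surface_measure R n.+2).
Notation S := (sphere R n.+2).
Notation cyl := (cylinder R n.+2).

Lemma modulus_ge0 (z : R[i]) : (0 <= modulus z)%R.
Proof. by case: z => p q; exact: sqrtr_ge0. Qed.

Lemma modulusE (z : R[i]) :
  modulus z = Num.sqrt (complex.Re z ^+ 2 + complex.Im z ^+ 2).
Proof. by case: z. Qed.

Lemma Re_le_modulus (z : R[i]) : (`|complex.Re z| <= modulus z)%R.
Proof. by rewrite modulusE -sqrtr_sqr ler_wsqrtr// lerDl sqr_ge0. Qed.

Lemma Im_le_modulus (z : R[i]) : (`|complex.Im z| <= modulus z)%R.
Proof. by rewrite modulusE -sqrtr_sqr ler_wsqrtr// lerDr sqr_ge0. Qed.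

Lemma modulus_le (z : R[i]) :
  (modulus z <= `|complex.Re z| + `|complex.Im z|)%R.
Proof.
rewrite modulusE -[leRHS]ger0_norm ?addr_ge0// -sqrtr_sqr ler_wsqrtr//.
rewrite sqrrD !real_normK ?num_real// lerD2r lerDl.
by rewrite mulrn_wge0// mulr_ge0.
Qed.

(** The transform is only defined almost everywhere, so that the measurability of
    its powers is not at hand; monotonicity does without it, the integral being a
    supremum over simple functions below the integrand. *)
Lemma le_integral_nonmeasurable (d : measure_display) (T : measurableType d)
    (mu : {measure set T -> \bar R}) (f g : T -> \bar R) :
  (forall x, 0 <= f x) -> (forall x, f x <= g x) ->
  \int[mu]_x f x <= \int[mu]_x g x.
Proof.
move=> f0 fg; have g0 x : 0 <= g x by exact: le_trans (fg x).
rewrite !ge0_integralTE//; apply: le_ereal_sup => _ [h hf <-].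
exists h => // x; exact: le_trans (hf x) (fg x).
Qed.

Lemma integral_null_bool (d : measure_display) (T : measurableType d)
    (mu : {measure set T -> \bar R}) (N : set T) :
  measurable_fun setT (fun z => `[< N z >]) -> mu N = 0 ->
  \int[mu]_z ((`[< N z >])%:R)%:E = 0.
Proof.
move=> mN N0; rewrite integral_bool// -[RHS]N0; congr (mu _).
by apply/seteqP; split=> z => [/asboolP|/asboolP].
Qed.

Variable G : R * V -> R[i].
Hypothesis GL : in_L2 G.

Let gr : RR * V -> \bar R := (fun z => (modulus (G z))%:E) \_ cyl.

Let mS : measurable S := @measurable_sphere R n.+2.

Lemma measurable_cylinder : measurable (cyl : set (RR * V)).
Proof. exact: measurableX. Qed.

Let mRe : measurable_fun (cyl : set (RR * V)) (fun z => complex.Re (G z)).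
Proof. by case: GL. Qed.

Let mIm : measurable_fun (cyl : set (RR * V)) (fun z => complex.Im (G z)).
Proof. by case: GL. Qed.

Let mgr : measurable_fun setT gr.
Proof.
apply/(measurable_restrictT _ measurable_cylinder).
apply/measurable_EFinP.
under eq_fun do rewrite modulusE.
apply: (@measurableT_comp _ _ _ _ _ _ (@Num.sqrt R)).
  by apply: continuous_measurable_fun; exact: sqrt_continuous.
by apply: measurable_funD; exact: measurable_funX.
Qed.

Let gr_fin z : exists2 y, (0 <= y)%R & gr z = y%:E.
Proof.
rewrite /gr patchE; case: ifP => _; last by exists 0%R.
by exists (modulus (G z)) => //; exact: modulus_ge0.
Qed.

Let gr0 z : 0 <= gr z.
Proof. by have [y y0 ->] := gr_fin z; rewrite lee_fin. Qed.

Lemma L2norm_fin : exists2 l : R, (0 <= l)%R &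
  L2norm G = l%:E /\ polar_int (fun z => gr z * gr z) = (l ^+ 2 / n.+2%:R)%:E.
Proof.
have [_ _ Gfin] := GL.
have L0 : 0 <= L2norm G by exact: Lnorm_ge0.
have LE : L2norm G = (fine (L2norm G))%:E by rewrite fineK// ge0_fin_numE.
exists (fine (L2norm G)); first exact: fine_ge0.
split=> //; set l := fine _ in LE *.
have l0 : (0 <= l)%R by exact: fine_ge0.
have two0 : (2 != 0 :> R)%R by rewrite pnatr_eq0.
have := poweR_Lnorm cylinder_measure gr two0.
rewrite -/(L2norm G) LE poweR_EFin powR_mulrn// => E.
have mgg : measurable_fun setT (fun z => gr z * gr z) by exact: emeasurable_funM.
have gg0 z : 0 <= gr z * gr z by exact: mule_ge0.
have := integral_cylinder mgg gg0.
rewrite (_ : \int[_]_z _ = (l ^+ 2)%:E); last first.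
  rewrite E; apply: eq_integral => z _.
  have [y y0 ->] := gr_fin z.
  by rewrite abse_EFin poweR_EFin powR_mulrn// real_normK ?num_real// -EFinM -expr2.
have d0 : (n.+2%:R != 0 :> R)%R by rewrite pnatr_eq0.
have : 0 <= polar_int (fun z => gr z * gr z).
  apply: integral_ge0 => w _; apply: mule_ge0 => //.
  exact: integral_ge0.
case: (polar_int _) => [t _ [->]| _ |//].
  by rewrite mulrAC divff// mul1r.
by rewrite gt0_muley// lte_fin ltr0n.
Qed.

Variables (a b : R).
Hypotheses (ab : (a < b)%R) (Gs : supported_in a b G).

(** The strip is measured through half-open intervals, hence the margin on the
    left of a; it only doubles the width. *)
Lemma supp_null : exists nul : RR * V -> bool,
  [/\ measurable_fun setT nul,
      polar_int (fun z => ((nul z)%:R)%:E) = 0 &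
      forall z, ~~ nul z -> ~~ ((2 * a - b < z.1) && (z.1 <= b))%R -> gr z = 0].
Proof.
have [N [mN N0 NG]] := Gs.
have mn : measurable_fun setT (fun z : RR * V => `[< N z >]).
  apply: (measurable_fun_bool true); rewrite setTI.
  by rewrite (_ : _ @^-1` _ = N)//; apply/seteqP; split=> z /= => [/asboolP|/asboolP].
exists (fun z => `[< N z >]); split=> //.
  have mi : measurable_fun setT (fun z : RR * V => ((`[< N z >]%:R : R))%:E).
    by measurability.
  have i0 (z : RR * V) : 0 <= ((`[< N z >]%:R : R))%:E by rewrite lee_fin.
  have := integral_cylinder mi i0.
  rewrite (integral_null_bool mn N0).
  move/esym/eqP; rewrite mule_eq0 => /orP[|/eqP//].
  by rewrite eqe pnatr_eq0.
move=> z /asboolPn Nz zab; rewrite /gr patchE; case: ifP => // zc.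
have zc' : cyl z by rewrite inE in zc.
have -> : G z = 0%R.
  apply: contrapT => Gz; apply: Nz; apply: NG => /= H.
  apply: Gz; apply: H => //; rewrite in_itv/=.
  apply: contra zab => /andP[az zb]; rewrite zb andbT.
  by apply: lt_le_trans az; move: ab; lra.
by rewrite modulusE /= expr0n/= addr0 sqrtr0.
Qed.

Let pt (x w : V) : RR * V := (dotp x w, w).

Let mpt x : measurable_fun setT (pt x).
Proof. by rewrite /pt; measurability. Qed.

Let pt_cyl x : pt x @` S `<=` cyl.
Proof. by move=> _ [w wS <-]; split. Qed.

Let gr_pt x w : S w -> gr (pt x w) = (modulus (G (pt x w)))%:E.
Proof.
move=> wS; by rewrite /gr patchE mem_set.
Qed.

Let gr_int x : \int[sigma]_(w in S) gr (pt x w) = n.+2%:R%:E * backproj gr x.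
Proof.
apply: (integral_surface (F := fun w => gr (pt x w))) => //.
exact: measurableT_comp.
Qed.

Lemma radon_adj_defined_fin x : backproj gr x < +oo -> radon_adj_defined G x.
Proof.
move=> fin; apply/integrableP; split.
  apply: (eq_measurable_fun (fun w => gr (pt x w))).
    by move=> w; rewrite inE => wS; rewrite gr_pt.
  by apply: measurable_funTS; exact: measurableT_comp.
rewrite (_ : \int[_]_(w in _) _ = n.+2%:R%:E * backproj gr x).
  by rewrite lte_mul_pinfty// lee_fin.
rewrite -gr_int; apply: eq_integral => w; rewrite inE => wS.
by rewrite gr_pt//= ger0_norm// modulus_ge0.
Qed.

Let part_le (p : R[i] -> R) x :
  (forall z, (`|p z| <= modulus z)%R) ->
  measurable_fun (cyl : set (RR * V)) (fun z => p (G z)) ->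
  (`|\int[sigma]_(w in S) p (G (pt x w))|)%:E <= n.+2%:R%:E * backproj gr x.
Proof.
move=> pm mp; rewrite /Rintegral.
have mpp : measurable_fun S (fun w => (p (G (pt x w)))%:E).
  apply/measurable_EFinP.
  apply: (measurable_comp measurable_cylinder (pt_cyl (x := x)) mp).
  exact: measurable_funTS.
apply: (@le_trans _ _ `|\int[sigma]_(w in S) (p (G (pt x w)))%:E|).
  by case: (\int[_]_(_ in _) _) => //=; rewrite normr0 leey.
apply: le_trans (le_abse_integral _ mS mpp) _.
rewrite -gr_int; apply: ge0_le_integral => //.
- exact: measurableT_comp.
- by apply: measurable_funTS; exact: measurableT_comp.
- by move=> w wS; rewrite gr_pt//= lee_fin.
Qed.

(** The real and the imaginary part are each bounded by the dual transform of the
    modulus. *)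
Lemma modulus_radon_adj x :
  (modulus (radon_adj G x) / (2 * n.+2%:R))%:E <= backproj gr x.
Proof.
have d0 : (0 < n.+2%:R :> R)%R by rewrite ltr0n.
have h1 := part_le x Re_le_modulus mRe.
have h2 := part_le x Im_le_modulus mIm.
have B0 : 0 <= backproj gr x by exact: backproj_ge0.
move: B0 h1 h2; rewrite /pt; case: (backproj gr x) => [B _| _ _ _ |//]; last by rewrite leey.
rewrite -EFinM !lee_fin => h1 h2.
rewrite ler_pdivrMr ?mulr_gt0//.
apply: le_trans (modulus_le _) _ => /=.
by move: h1 h2; set u := (`|_|)%R; set v := (`|_|)%R => h1 h2; lra.
Qed.

Hypothesis n2 : (2 <= n)%N.

Lemma radon_adj_Lp (r : R) (l : R) : (0 < r)%R ->
  polar_int (fun z => gr z * gr z) = (l ^+ 2 / n.+2%:R)%:E ->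
  exists W : V -> \bar R,
  [/\ measurable_fun setT W, forall x, 0 <= W x,
    \int[lam n.+2]_x W x <=
      (strip_vol n (2 * a - b) b r *
        (backproj_const n * (l ^+ 2 / n.+2%:R)) ^+ n.+2)%:E &
    forall x (y : R), (r < enorm x)%R -> (0 <= y)%R -> y%:E <= backproj gr x ->
      (y ^+ (2 * n.+2))%:E <= W x].
Proof.
move=> r0 lE; have [nul [mnul nul0 supp]] := supp_null.
have ab' : (2 * a - b < b)%R by move: ab; lra.
apply: (backproj_Lp n2 ab' r0 mgr gr0 mnul nul0 supp).
by rewrite lE.
Qed.

(** The estimate outside the balls of radius 1 / (k + 1) shows that the dual
    transform of the modulus is finite almost everywhere there. *)
Lemma radon_adj_defined_ae : {ae lam n.+2, forall x, radon_adj_defined G x}.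
Proof.
have [l l0 [_ lE]] := L2norm_fin.
have far (k : nat) : \forall x \ae lam n.+2,
    (k.+1%:R^-1 < enorm x)%R -> radon_adj_defined G x.
  have k0 : (0 < k.+1%:R^-1 :> R)%R by rewrite invr_gt0 ltr0n.
  have [W [mW W0 Wi WP]] := radon_adj_Lp k0 lE.
  have Wint : (lam n.+2).-integrable setT W.
    apply/integrableP; split => //.
    apply: le_lt_trans (ltry _); apply: le_trans Wi.
    rewrite le_eqVlt; apply/orP; left; apply/eqP.
    by apply: eq_integral => x _; rewrite gee0_abs.
  have := integrable_ae measurableT Wint.
  apply: filterS => x /(_ Logic.I) Wx kx.
  apply: radon_adj_defined_fin; rewrite ltNge leye_eq; apply/negP => /eqP Boo.
  have w0 : (0 <= fine (W x))%R by exact: fine_ge0.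
  have y0 : (0 <= 1 + fine (W x))%R by lra.
  have := WP x _ kx y0; rewrite Boo leey => /(_ isT).
  rewrite -(fineK Wx) lee_fin leNgt => /negP; apply.
  apply: (@lt_le_trans _ _ (1 + fine (W x))%R); first by rewrite ltrDr.
  by apply: ler_eXnr => //; rewrite lerDl.
have orig : \forall x \ae lam n.+2, (enorm x != 0)%R.
  exists [set v | ~~ (enorm v != 0%R)]; split; last by move=> x /= /negP.
    have mo : measurable_fun setT (fun v : V => ~~ (enorm v != 0%R)).
      by measurability.
    rewrite -[X in measurable X]setTI.
    exact: (mo measurableT [set true]).
  exact: origin_null.
have := ae_foralln far; apply: filterS2 orig => x x0 H.
have ex : (0 < enorm x)%R by rewrite lt_neqAle eq_sym x0 enorm_ge0.
have [k kx] : exists k : nat, (k.+1%:R^-1 < enorm x)%R.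
  exists (Num.bound (enorm x)^-1).
  rewrite invf_plt ?posrE ?ltr0n//.
  apply: lt_le_trans (archi_boundP _) _; first by rewrite invr_ge0 enorm_ge0.
  by rewrite ler_nat.
exact: (H k).
Qed.

Definition radon_const : R :=
  ((2 * n.+2%:R) ^+ (2 * n.+2) * (2 * ball_vol n.+1 * 2 ^+ n.+1) *
    (backproj_const n / n.+2%:R) ^+ n.+2)%R.

Lemma radon_adj_bound (r : R) : (0 < r)%R ->
  \int[lam n.+2]_(x in [set x | (r < enorm x)%R])
     (modulus (radon_adj G x) ^+ (2 * n.+2))%:E
  <= (radon_const * ((b - a) / r) ^+ n.+1)%:E * L2norm G ^+ (2 * n.+2).
Proof.
move=> r0; have [l l0 [LE lE]] := L2norm_fin.
have [W [mW W0 Wi WP]] := radon_adj_Lp r0 lE.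
have d0 : (0 < 2 * n.+2%:R :> R)%R by rewrite mulr_gt0// ltr0n.
pose K : R := ((2 * n.+2%:R) ^+ (2 * n.+2))%R.
have K0 : (0 <= K)%R by apply: exprn_ge0; exact: ltW.
rewrite integral_mkcond.
apply: (@le_trans _ _ (\int[lam n.+2]_x (K%:E * W x))).
  apply: le_integral_nonmeasurable => x; rewrite patchE; case: ifP => //.
    by move=> _; rewrite lee_fin exprn_ge0// modulus_ge0.
    rewrite inE/= => rx.
    have y0 : (0 <= modulus (radon_adj G x) / (2 * n.+2%:R))%R.
      by rewrite divr_ge0 ?modulus_ge0// ltW.
    have := WP x _ rx y0 (modulus_radon_adj x).
    move=> /(lee_wpmul2l (_ : 0 <= K%:E)) H; apply: le_trans (H _); last by rewrite lee_fin.
    rewrite -EFinM lee_fin /K -exprMn mulrC divfK// gt_eqF.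
  by move=> _; rewrite mule_ge0// lee_fin.
rewrite ge0_integralZ//.
apply: le_trans (lee_wpmul2l _ Wi) _; first by rewrite lee_fin.
rewrite LE -EFin_expe -!EFinM lee_fin le_eqVlt; apply/orP; left; apply/eqP.
rewrite /radon_const /strip_vol -/K.
rewrite (_ : b - (2 * a - b) = 2 * (b - a))%R; last by lra.
rewrite -(mulrA 2%R (b - a)%R) (exprMn _ 2%R).
have -> : ((backproj_const n * (l ^+ 2 / n.+2%:R)) ^+ n.+2 =
           (backproj_const n / n.+2%:R) ^+ n.+2 * l ^+ (2 * n.+2))%R.
  by rewrite [in RHS]exprM -exprMn; congr (_ ^+ _)%R; ring.
move: (_ / n.+2%:R)%R (_ / r)%R (l ^+ _)%R (ball_vol _) => q s t v.
by move: (q ^+ _)%R (s ^+ _)%R (2 ^+ _)%R => q' s' p; ring.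
Qed.

End square_integrable.

Lemma radon_const_gt0 {R : realType} n : 0 < (radon_const n : R).
Proof.
have d0 : 0 < n.+2%:R :> R by rewrite ltr0n.
have w0 : 0 < weak_const n.+1 :> R by rewrite /weak_const addr_gt0// exprn_gt0.
have k0 := @kernel_const_gt0 R n; have b0 := @ball_vol_gt0 R n.+1.
by rewrite /radon_const /backproj_const; do ![assumption|apply: exprn_gt0
  |rewrite invr_gt0|apply: mulr_gt0].
Qed.

Theorem corollary1p10 (R : realType) (d : nat) (hd : (4 <= d)%N) :
  exists C : R, 0 < C /\
    forall (a b : R) (G : R * d.-tuple R -> R[i]),
      a < b -> in_L2 G -> supported_in a b G ->
      {ae lebesgue_tuple R d, forall x, radon_adj_defined G x} /\
      forall r : R, 0 < r ->
        (\int[lebesgue_tuple R d]_(x in [set x | (r < enorm x)%R])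
            (modulus (radon_adj G x) ^+ (2 * d))%:E
         <= (C * ((b - a) / r) ^+ (d - 1))%:E * L2norm G ^+ (2 * d))%E.
Proof.
case: d hd => [//|[//|n]] n2; exists (radon_const n).
split=> [|a b G ab GL Gs]; first exact: radon_const_gt0.
split; first exact: (radon_adj_defined_ae GL ab Gs).
by move=> r r0; rewrite subn1; exact: radon_adj_bound.
Qed.
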